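(* Let $d_1,d_2$ be integers with $2 \leq d_1 \leq d_2$. Consider the line arrangement $\mathcal{A} : f=0$ in $\mathbb{P}^2$ (over $\mathbb{C}$) given by $$f(x,y,z)= x(y-z)\,g_{1,d_1-1}(x,y)\,g_{2,d_2}(x,z)=0,$$ where for integers $i\le j$, $g_{i,j}(u,v)=(u-iv)(u-(i+1)v)\cdots(u-jv)$. Let $M(\mathcal{A})$ denote the complement of $\mathcal{A}$ in $\mathbb{P}^2$. Then $M(\mathcal{A})$ is not a $K(\pi,1)$-space if either $d_1=2$ or $d_1=d_2=3$.
   Context: A $K(\pi,1)$-space is a connected space whose homotopy groups $\pi_k$ vanish for all $k\ge 2$. *)

(* Defs.v *)
From HB Require Import structures.
From mathcomp Require Import all_boot all_order all_algebra.
From mathcomp Require Import complex.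
From mathcomp Require Import all_classical all_reals all_analysis.

Set Implicit Arguments.
Unset Strict Implicit.
Unset Printing Implicit Defensive.

Import Order.TTheory GRing.Theory Num.Theory.
Import numFieldNormedType.Exports.

Local Open Scope classical_set_scope.
Local Open Scope ring_scope.
Local Open Scope quotient_scope.
Local Open Scope complex_scope.

(* The usual topology of the complex numbers, from the norm on R[i]. *)
HB.instance Definition _ (R : rcfType) := NormedModule.copy R[i] R[i]^o.

Section HomotopyGroups.
Variable R : realType.

Definition unit_interval : set R := `[0, 1]%classic.

Definition cube (k : nat) : set 'rV[R]_k :=
  [set s | forall i, unit_interval (s 0 i)].
Arguments cube k _ : clear implicits.

Definition cube_boundary (k : nat) : set (cube k) :=
  [set s : cube k | exists i, set_val s 0 i = 0 \/ set_val s 0 i = 1].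

Variable X : topologicalType.

Record spheroid (k : nat) (x0 : X) := Spheroid {
  spheroid_fun :> cube k -> X;
  spheroid_continuous : continuous spheroid_fun;
  spheroid_boundary : forall s, cube_boundary s -> spheroid_fun s = x0 }.

Definition homotopic (k : nat) (x0 : X) (f g : spheroid k x0) : Prop :=
  exists H : unit_interval * cube k -> X,
    [/\ continuous H,
        forall t s, set_val t = 0 -> H (t, s) = f s,
        forall t s, set_val t = 1 -> H (t, s) = g s &
        forall t s, cube_boundary s -> H (t, s) = x0].

Definition cst_spheroid (k : nat) (x0 : X) : spheroid k x0 :=
  @Spheroid k x0 (cst x0) (fun s => @cst_continuous _ _ x0 s) (fun _ _ => erefl).

(* The underlying pointed set of pi_k(X, x0): its elements are the homotopy
   classes (as sets of spheroids), and the neutral element is the class of the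
   constant spheroid. The group law is not needed to say that pi_k vanishes. *)
Definition homotopy_class (k : nat) (x0 : X) (f : spheroid k x0) :
  set (spheroid k x0) := [set g | homotopic f g].

Definition homotopy_group (k : nat) (x0 : X) : set (set (spheroid k x0)) :=
  range (@homotopy_class k x0).
Arguments homotopy_group k x0 _ : clear implicits.

Definition homotopy_group_vanishes (k : nat) (x0 : X) : Prop :=
  homotopy_group k x0 = [set homotopy_class (cst_spheroid k x0)].

Definition is_Kpi1 : Prop :=
  connected [set: X] /\
  forall (x0 : X) (k : nat), (2 <= k)%N -> homotopy_group_vanishes k x0.

End HomotopyGroups.

Arguments unit_interval R _ : clear implicits.
Arguments cube R k _ : clear implicits.

Section ProjectivePlane.
Variable R : realType.

Definition punctured_C3 : set 'rV[R[i]]_3 := [set v | v != 0].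

Definition proj_rel (v w : punctured_C3) : bool :=
  `[< exists2 a : R[i], a != 0 & set_val w = a *: set_val v >].

Lemma proj_rel_refl : reflexive proj_rel.
Proof. by move=> v; apply/asboolP; exists 1; rewrite ?oner_neq0 ?scale1r. Qed.

Lemma proj_rel_sym : symmetric proj_rel.
Proof.
suff sub v w : proj_rel v w -> proj_rel w v.
  by move=> v w; apply/idP/idP; exact: sub.
move=> /asboolP[a a0 wE]; apply/asboolP; exists a^-1; first by rewrite invr_eq0.
by rewrite wE scalerA mulVf ?scale1r.
Qed.

Lemma proj_rel_trans : transitive proj_rel.
Proof.
move=> v u w /asboolP[a a0 uE] /asboolP[b b0 wE]; apply/asboolP.
by exists (b * a); rewrite ?mulf_neq0// wE uE scalerA.
Qed.

Canonical proj_equiv :=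
  EquivRel proj_rel proj_rel_refl proj_rel_sym proj_rel_trans.

Definition P2 : topologicalType := quotient_topology {eq_quot proj_equiv}.

Definition P2_pi (v : punctured_C3) : P2 :=
  \pi_(quotient_topology {eq_quot proj_equiv}) v.

End ProjectivePlane.

Arguments punctured_C3 R _ : clear implicits.
Arguments P2_pi {R} v.

Section Arrangement.
Variable R : realType.
Implicit Types x y z u v : R[i].

Definition arr_g (i j : nat) u v : R[i] :=
  \prod_(i <= k < j.+1) (u - k%:R * v).

Definition arr_f (d1 d2 : nat) x y z : R[i] :=
  x * (y - z) * arr_g 1 (d1 - 1) x y * arr_g 2 d2 x z.

(* arr_f is homogeneous, so this is the zero locus of f in P2. *)
Definition arrangement (d1 d2 : nat) : set (P2 R) :=
  [set P2_pi p | p in [set p : punctured_C3 R |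
     arr_f d1 d2 (set_val p 0 0) (set_val p 0 1) (set_val p 0 2) = 0]].

Definition arrangement_complement (d1 d2 : nat) : topologicalType :=
  set_type (~` @arrangement d1 d2).

End Arrangement.

Arguments arrangement R d1 d2 _ : clear implicits.

(* Main.v *)
Require Import Defs.
From mathcomp Require Import all_boot all_order all_algebra.
From mathcomp Require Import complex.
From mathcomp Require Import all_classical all_reals all_analysis.
From mathcomp Require Import ring lra zify.

(* Put x = 1. If d1 = 2, the linear forms a = 1 - y, b = y - z, c = z - 1/2 satisfy
   a + b + c = 1/2 and do not vanish on M(A). If d1 = d2 = 3, then u = 2y - 1,
   v = (2z - 1)/(2y - 1), w = -1/(3(2z - 1)) omit 0 and 1 and satisfy uvw = -1/3;
   logarithms of u, v, w whose sum is tau = -ln 3 + i pi exist along any map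
   from a cube and never vanish, and they satisfy a + b + c = tau.
   So in both cases it is enough to find a 2-sphere in the complement N of three
   generic lines {a + b + c = 1, abc <> 0} which is not contractible in N and which
   can be realised in M(A). The triple of arguments of a point of N lifts, along a
   map from a cube, to a map into R^3, which never takes the value (pi, pi, pi), since a, b, c
   are not all negative. The sphere is chosen so that its arguments wind once
   around (pi, pi, pi). A null homotopy would then give a map from the cube to
   R^3 minus a point with nonzero degree on the boundary; this is excluded by
   counting, on a fine grid, the cubical cup product of the coboundaries of the
   signs of the three coordinates, which depends on the boundary values only. *)

Set Implicit Arguments.
Unset Strict Implicit.
Unset Printing Implicit Defensive.

Import Order.TTheory GRing.Theory Num.Theory.
Import numFieldNormedType.Exports.

Local Open Scope classical_set_scope.
Local Open Scope ring_scope.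
Local Open Scope quotient_scope.
Local Open Scope complex_scope.

Local Notation re := (@complex.Re _).
Local Notation im := (@complex.Im _).

(** * Cubical cup products on a grid *)

Definition cst_on_cell (s : nat -> nat -> nat -> int) (k i j : nat) :=
  forall a b c : bool, s (k + a)%N (i + b)%N (j + c)%N = s k i j.

(* The cubical cup product of s, dt and du on the square with lower corner (i, j). *)
Definition cup2 (s t u : nat -> nat -> int) (i j : nat) : int :=
  s i j * ((t i.+1 j - t i j) * (u i.+1 j.+1 - u i.+1 j)
           - (t i j.+1 - t i j) * (u i.+1 j.+1 - u i j.+1)).

Lemma cup2_cst (s t u : nat -> nat -> int) (ct cu : int) i j :
  (forall a b : bool, t (i + a)%N (j + b)%N = ct) ->
  (forall a b : bool, u (i + a)%N (j + b)%N = cu) ->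
  cup2 s t u i j = 0.
Proof.
move=> tE uE; rewrite /cup2.
have := tE false false; have := tE true false; have := tE false true.
rewrite !addn0 !addn1 => -> -> ->; ring.
Qed.

(* Stokes' formula for s1 u ds2 u ds3, whose coboundary ds1 u ds2 u ds3 vanishes on
   every cell on which one of the three functions is constant. *)
Lemma cup_product_boundary (N : nat) (s1 s2 s3 : nat -> nat -> nat -> int) (c2 c3 : int) :
  (forall k i j, (k < N)%N -> (i < N)%N -> (j < N)%N ->
     [\/ cst_on_cell s1 k i j, cst_on_cell s2 k i j | cst_on_cell s3 k i j]) ->
  (forall k i j, (k <= N)%N -> (i <= N)%N -> (j <= N)%N ->
     [|| k == 0, i == 0, i == N, j == 0 | j == N]%N ->
     s2 k i j = c2 /\ s3 k i j = c3) ->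
  \sum_(0 <= i < N) \sum_(0 <= j < N) cup2 (s1 N) (s2 N) (s3 N) i j = 0.
Proof.
move=> cell bnd.
(* [F1], [F2], [F3] evaluate the same 2-cochain on the faces orthogonal to the directions [k], [i]
   and [j]; the last two arguments are the coordinates along the face. *)
pose F1 k i j := cup2 (s1 k) (s2 k) (s3 k) i j.
pose F2 i k j := cup2 (s1^~ i) (s2^~ i) (s3^~ i) k j.
pose F3 j k i := cup2 (fun k i => s1 k i j) (fun k i => s2 k i j)
  (fun k i => s3 k i j) k i.
have bF (p : nat -> nat -> int) (q1 q2 : nat -> nat -> int) a b :
    (a < N)%N -> (b < N)%N ->
    (forall a b, (a <= N)%N -> (b <= N)%N -> q1 a b = c2 /\ q2 a b = c3) ->
    cup2 p q1 q2 a b = 0.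
  move=> aN bN q; rewrite (@cup2_cst _ _ _ c2 c3)// => x y;
    by apply q; case: x; case: y; lia.
(* The alternating sum over the six faces of a cell is the triple product of coboundaries. After
   substitution of the eight vertex values of the constant function it vanishes identically. *)
have dF k i j : (k < N)%N -> (i < N)%N -> (j < N)%N ->
    (F1 k.+1 i j - F1 k i j) - (F2 i.+1 k j - F2 i k j)
    + (F3 j.+1 k i - F3 j k i) = 0.
  move=> kN iN jN; rewrite /F1 /F2 /F3 /cup2.
  case: (cell k i j kN iN jN) => c;
  move: (c true true true) (c true true false) (c true false true)
    (c true false false) (c false true true) (c false true false)
    (c false false true);
  rewrite !addn0 !addn1 => e1 e2 e3 e4 e5 e6 e7;
  rewrite ?e1 ?e2 ?e3 ?e4 ?e5 ?e6 ?e7; ring.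
(* Summed over all cells, the face terms telescope. The walls in the directions [i] and [j] and the
   floor [k = 0] contribute nothing, since [s2] and [s3] are constant there; only the top [k = N] is
   left. *)
have : \sum_(0 <= k < N) \sum_(0 <= i < N) \sum_(0 <= j < N)
    ((F1 k.+1 i j - F1 k i j) - (F2 i.+1 k j - F2 i k j)
    + (F3 j.+1 k i - F3 j k i)) = 0.
  rewrite big_nat big1// => k /andP[_ kN].
  rewrite big_nat big1// => i /andP[_ iN].
  by rewrite big_nat big1// => j /andP[_ jN]; exact: dF.
under eq_bigr do under eq_bigr do rewrite big_split sumrB /=.
under eq_bigr do rewrite big_split sumrB /=.
rewrite big_split sumrB /=.
have -> : \sum_(0 <= k < N) \sum_(0 <= i < N) \sum_(0 <= j < N)
    (F3 j.+1 k i - F3 j k i) = 0.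
  rewrite big_nat big1// => k /andP[_ kN].
  rewrite big_nat big1// => i /andP[_ iN].
  rewrite telescope_sumr// /F3 !bF ?subrr// => a b aN bN; apply bnd => //;
    by rewrite ?eqxx ?orbT.
have -> : \sum_(0 <= k < N) \sum_(0 <= i < N) \sum_(0 <= j < N)
    (F2 i.+1 k j - F2 i k j) = 0.
  rewrite big_nat big1// => k /andP[_ kN].
  rewrite exchange_big big_nat big1// => j /andP[_ jN].
  rewrite telescope_sumr// /F2 !bF ?subrr// => a b aN bN; apply bnd => //;
    by rewrite ?eqxx ?orbT.
rewrite subr0 addr0 exchange_big /= => h; rewrite -[RHS]h.
apply: eq_big_nat => i /andP[_ iN].
rewrite exchange_big; apply: eq_big_nat => j /andP[_ jN].
rewrite telescope_sumr// [F1 0%N i j]bF ?subr0// => a b aN bN.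
by apply bnd.
Qed.

(** Where [s1] is nonzero, all four vertices of the square are interior, so [s2] depends on [i] only
    and [s3] on [j] only. The product of their jumps is then nonzero only on the square with lower
    corner [(M, M)], because both functions jump between [M] and [M + 1]. *)
Lemma cup_product_centre (M : nat) (s1 s2 s3 : nat -> nat -> int) : (2 < M)%N ->
  s1 M M = 1 ->
  (forall i j, (i <= 2 * M)%N -> (j <= 2 * M)%N -> s1 i j != 0 ->
     (1 < i)%N && (i < (2 * M).-1)%N && (1 < j)%N && (j < (2 * M).-1)%N) ->
  (forall i j, (0 < i < 2 * M)%N -> (0 < j < 2 * M)%N ->
     s2 i j = (M < i)%N%:Z /\ s3 i j = (M < j)%N%:Z) ->
  \sum_(0 <= i < 2 * M) \sum_(0 <= j < 2 * M) cup2 s1 s2 s3 i j = 1.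
Proof.
move=> M2 s1M s1z s23.
have E i j : (i < 2 * M)%N -> (j < 2 * M)%N ->
    cup2 s1 s2 s3 i j = ((i == M) && (j == M))%:Z.
  move=> iM jM; have [s10|/s1z] := eqVneq (s1 i j) 0.
    rewrite /cup2 s10 mul0r; case: eqP => //= ?; case: eqP => //= ?; subst.
    by move: s10; rewrite s1M.
  move=> h; have {h} /andP[/andP[/andP[i1 i2] j1] j2] := h (ltnW iM) (ltnW jM).
  rewrite /cup2.
  have [-> _] := s23 i j ltac:(lia) ltac:(lia).
  have [-> ->] := s23 i.+1 j ltac:(lia) ltac:(lia).
  have [_ ->] := s23 i.+1 j.+1 ltac:(lia) ltac:(lia).
  have [-> _] := s23 i j.+1 ltac:(lia) ltac:(lia).
  rewrite subrr mul0r subr0.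
  have [->|iM'] := eqVneq i M; last first.
    rewrite /= (_ : (M < i.+1)%N = (M < i)%N) ?subrr ?mul0r ?mulr0//; lia.
  have [->|jM'] := eqVneq j M; last first.
    rewrite /= (_ : (M < j.+1)%N = (M < j)%N) ?subrr ?mul0r ?mulr0//; lia.
  by rewrite s1M !ltnn !ltnSn.
have MM : (M < 2 * M)%N by lia.
rewrite big_nat (eq_bigr (fun i => (i == M)%:Z)); last first.
  move=> i /andP[_ iM].
  rewrite big_nat (eq_bigr (fun j => ((i == M) && (j == M))%:Z)); last first.
    by move=> j /andP[_ jM]; rewrite E.
  rewrite -big_nat big_mkord (bigD1 (Ordinal MM))//= eqxx andbT.
  rewrite big1 ?addr0// => j; rewrite -val_eqE /=.
  by case: (j =P M :> nat) => //; rewrite andbF.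
rewrite -big_nat big_mkord (bigD1 (Ordinal MM))//= eqxx big1 ?addr0// => j.
by rewrite -val_eqE /=; case: eqP.
Qed.

(** * Uniform continuity and the existence of a common zero *)

Lemma ord3_ind (P : 'I_3 -> Prop) : P 0 -> P 1 -> P 2 -> forall i, P i.
Proof.
move=> P0 P1 P2 [[|[|[|//]]] lti].
- by rewrite (_ : Ordinal lti = 0)//; exact: val_inj.
- by rewrite (_ : Ordinal lti = 1)//; exact: val_inj.
- by rewrite (_ : Ordinal lti = 2)//; exact: val_inj.
Qed.

Section UniformContinuity.
Variables (R : realType) (V W : pseudoMetricType R).

(** By compactness a radius has only to be found locally, and half of a radius that works at [x]
    with precision [e / 2] serves all points near [x]. *)
Lemma compact_uniform_continuity (f : V -> W) (K : set V) (e : R) :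
  compact K -> continuous f -> 0 < e ->
  exists2 d, 0 < d & forall x y, K x -> ball x d y -> ball (f x) e (f y).
Proof.
move=> /compact_near_coveringP Kc cf e0.
have H : \forall d \near 0^'+, forall x, K x ->
    forall y, ball x d y -> ball (f x) e (f y).
  apply: Kc => x Kx.
  have /nbhs_ballP[d /= d0 sub] : nbhs x (f @^-1` ball (f x) (e / 2)).
    by apply: cf; apply: nbhsx_ballx; rewrite divr_gt0.
  near=> x' d'.
  have xx' : ball x (d / 2) x'.
    by near: x'; apply: nbhsx_ballx; rewrite divr_gt0.
  have d'd : d' < d / 2 by near: d'; apply: nbhs_right_lt; rewrite divr_gt0.
  move=> y x'y.
  apply: (@ball_splitr _ _ (f x)).
    apply: sub; apply: le_ball xx'; lra.
  apply: sub; rewrite [d]splitr; apply: ball_triangle xx' _.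
  by apply: le_ball x'y; exact: ltW.
near (0:R)^'+ => d; exists d; first by near: d; exact: nbhs_right_gt.
have Hd : forall x, K x -> forall y, ball x d y -> ball (f x) e (f y).
  by near: d.
by move=> x y Kx; exact: Hd.
Unshelve. all: by end_near. Qed.
End UniformContinuity.

Lemma continuous_pair (T U W : topologicalType) (f : T -> U) (g : T -> W) :
  continuous f -> continuous g -> continuous (fun x => (f x, g x)).
Proof. by move=> cf cg x; exact: cvg_pair (cf x) (cg x). Qed.

Section Degree.
Variable R : realType.
Local Notation V := (R * R * R)%type.

Definition box : set V := `[0, 1] `*` `[0, 1] `*` `[0, 1].

Lemma boxP (p : V) : box p <->
  [/\ 0 <= p.1.1 <= 1, 0 <= p.1.2 <= 1 & 0 <= p.2 <= 1].
Proof.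
by case: p => [[t x] y]; rewrite /box /= !in_itv /=; split=> [[[]]|[]].
Qed.

Lemma compact_box : compact box.
Proof. by apply: compact_setX; [apply: compact_setX|]; exact: segment_compact. Qed.

Lemma continuous_pair3 (T : topologicalType) (G : 'I_3 -> T -> R) :
  (forall i, continuous (G i)) ->
  continuous (fun p => (G 0 p, G 1 p, G 2 p) : V).
Proof.
by move=> cG; do 2!apply: continuous_pair => //.
Qed.

(** This turns a change of sign inside a grid cell into smallness: the value at a vertex is bounded
    by the oscillation over the cell. *)
Lemma norm_le_sign_change (x y : R) :
  (x <= 0) != (y <= 0) -> `|x| <= `|x - y|.
Proof.
case: (lerP x 0) => hx; case: (lerP y 0) => // hy _.
  by rewrite ler0_norm// ler0_norm; lra.
by rewrite gtr0_norm// ger0_norm; lra.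
Qed.

Lemma half_between : (1 / 4 : R) <= (1 / 2 : R) <= (3 / 4 : R).
Proof. by apply/andP; split; lra. Qed.

Lemma grid_middle (q N i : R) : 3 <= N -> q * (2 * N) = i ->
  1 / 4 <= q <= 3 / 4 -> 1 < i /\ i < 2 * N - 1.
Proof. by move=> N3 <- /andP[q1 q2]; split; nra. Qed.

Lemma grid_half (q N i : R) : 3 <= N -> q * (2 * N) = i ->
  (1 / 2 < q) = (N < i).
Proof. by move=> N3 <-; apply/idP/idP => ?; nra. Qed.

Lemma grid_inside (q N i : R) : 3 <= N -> q * (2 * N) = i ->
  0 < i -> i < 2 * N -> 0 < q < 1.
Proof. by move=> N3 <- h1 h2; apply/andP; split; nra. Qed.

(** Without a common zero, the sum [m] of the absolute values has a positive minimum on the box. On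
    a fine grid each component varies by less than a third of it within a cell, so on every cell one
    of the three signs is constant; otherwise all three components would be too small at the lower
    corner. The cup product sum over the top face would then be 0 by [cup_product_boundary], whereas
    the prescribed signs on that face make it 1 by [cup_product_centre]. *)
Lemma common_zero (G : 'I_3 -> V -> R) :
  (forall i, continuous (G i)) ->
  (forall x y : R, 0 <= x <= 1 -> 0 <= y <= 1 ->
    [/\ (G 0 (1, x, y) <= 0) = (1 / 4 <= x <= 3 / 4) && (1 / 4 <= y <= 3 / 4),
        0 < x < 1 -> 0 < y < 1 -> (G 1 (1, x, y) > 0) = (x > 1 / 2)
      & 0 < x < 1 -> 0 < y < 1 -> (G 2 (1, x, y) > 0) = (y > 1 / 2)]) ->
  (forall p, box p -> [|| p.1.1 == 0, p.1.2 == 0, p.1.2 == 1, p.2 == 0 | p.2 == 1] ->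
    G 1 p <= 0 /\ G 2 p <= 0) ->
  exists2 p, box p & forall i, G i p = 0.
Proof.
move=> cG sph bnd; apply: contrapT => noz.
pose m (p : V) : R := `|G 0 p| + `|G 1 p| + `|G 2 p|.
have cm : continuous m.
  by move=> p; apply: cvgD; [apply: cvgD|]; apply: cvg_norm; exact: cG.
have box0 : box !=set0 by exists (0, 0, 0); apply/boxP; rewrite /= lexx ler01.
have [p0 /set_mem p0K minm] :=
  compact_EVT_min box0 compact_box (continuous_subspaceT cm).
have m0 : 0 < m p0.
  rewrite lt_neqAle eq_sym !addr_ge0// andbT; apply/eqP => mp0; apply: noz.
  exists p0 => // i; apply/eqP; rewrite -normr_le0.
  have := (normr_ge0 (G 0 p0), normr_ge0 (G 1 p0), normr_ge0 (G 2 p0)).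
  move=> -[[h0 h1] h2]; move: mp0; rewrite /m.
  by elim/ord3_ind: i; lra.
have e0 : 0 < m p0 / 3 by rewrite divr_gt0.
have [d d0 unif] :=
  compact_uniform_continuity compact_box (continuous_pair3 cG) e0.
have [n nd] : exists n : nat, d^-1 < n%:R.
  by exists (Num.bound d^-1); apply: archi_boundP; rewrite invr_ge0 ltW.
(* The mesh [1 / (2 * M)] is below [d]. An even number of steps makes [1 / 2] the grid point of
   index [M], and [3 <= M] keeps the indices of points in [[1/4, 3/4]] strictly between [1] and
   [2 * M - 1]. *)
pose M := (n + 3)%N.
pose q (k : nat) : R := k%:R / (2 * M)%:R.
have M0 : 0 < (2 * M)%:R :> R by rewrite ltr0n /M; lia.
have q01 k : (k <= 2 * M)%N -> 0 <= q k <= 1.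
  move=> kM; rewrite divr_ge0//= ?ler0n// ler_pdivrMr// mul1r ler_nat//.
pose P k i j : V := (q k, q i, q j).
have KP k i j : (k <= 2 * M)%N -> (i <= 2 * M)%N -> (j <= 2 * M)%N ->
    box (P k i j).
  by move=> *; apply/boxP; split; exact: q01.
have near_q k (a : bool) : `|q k - q (k + a)%N| < d.
  rewrite /q -mulrBl natrD opprD addrA subrr sub0r normrM normrN ger0_norm ?ler0n//.
  rewrite ger0_norm ?invr_ge0 ?ler0n// ltr_pdivrMr//.
  apply: (@le_lt_trans _ _ 1); first by rewrite lern1; case: a.
  rewrite -ltr_pdivrMl// mulr1; apply: lt_trans nd _; rewrite ltr_nat /M; lia.
(* The inequality is reversed for [s1], so that on the top face it is supported on the central
   square, while [s2] and [s3] vanish on the walls. *)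
pose s1 k i j : int := (G 0 (P k i j) <= 0)%R%:Z.
pose s2 k i j : int := (0 < G 1 (P k i j))%R%:Z.
pose s3 k i j : int := (0 < G 2 (P k i j))%R%:Z.
have small (g : 'I_3) (s : nat -> nat -> nat -> int) k i j :
    (k < 2 * M)%N -> (i < 2 * M)%N -> (j < 2 * M)%N ->
    (forall k' i' j', s k i j != s k' i' j' ->
       `|G g (P k i j)| <= `|G g (P k i j) - G g (P k' i' j')|) ->
    ~ cst_on_cell s k i j -> `|G g (P k i j)| < m p0 / 3.
  move=> kM iM jM sG /existsNP[b] /existsNP[c] /existsNP[e] /eqP.
  rewrite eq_sym => /sG /le_lt_trans; apply.
  have [] := unif _ (P (k + b) (i + c) (j + e))%N
    (KP _ _ _ (ltnW kM) (ltnW iM) (ltnW jM)).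
    by split; [split|]; apply: near_q.
  by move: (g) => g' [h0 h1] h2; elim/ord3_ind: g'.
suff : \sum_(0 <= i < 2 * M) \sum_(0 <= j < 2 * M)
    cup2 (s1 (2 * M)%N) (s2 (2 * M)%N) (s3 (2 * M)%N) i j = 0.
  have qN : q (2 * M)%N = 1 by rewrite /q divff// gt_eqF.
  have N2 : (2 * M)%:R = 2 * M%:R :> R by rewrite natrM.
  have M3 : 3 <= M%:R :> R by rewrite ler_nat /M; lia.
  have qE k : q k * (2 * M%:R) = k%:R by rewrite -N2 divfK// gt_eqF.
  rewrite cup_product_centre //; first by rewrite /M; lia.
  - rewrite /s1 /P qN.
    have [-> _ _] := sph (q M) (q M) (q01 M ltac:(lia)) (q01 M ltac:(lia)).
    have -> : q M = 1 / 2.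
      by apply: (@mulIf _ (2 * M%:R)); [rewrite gt_eqF//|rewrite qE]; lra.
    by rewrite !half_between.
  - have q12 i : (1 / 4 <= q i <= 3 / 4) -> (1 < i)%N /\ (i < (2 * M).-1)%N.
      move=> /(grid_middle M3 (qE i))[h1 h2].
      split; first by rewrite -(ltr_nat R).
      by rewrite -(ltr_nat R) -subn1 natrB ?N2//; rewrite /M; lia.
    move=> i j iM jM; rewrite /s1 /P qN.
    have [-> _ _] := sph (q i) (q j) (q01 _ iM) (q01 _ jM).
    case: andP => // -[/q12[i1 i2] /q12[j1 j2]] _.
    by rewrite i1 i2 j1 j2.
  - have q12 i : (0 < i)%N -> (i < 2 * M)%N -> 0 < q i < 1.
      by rewrite -!(ltr_nat R) N2; exact: (grid_inside M3 (qE i)).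
    have qh i : (1 / 2 < q i) = (M < i)%N.
      by rewrite -(ltr_nat R) (grid_half M3 (qE i)).
    move=> i j /andP[i0 iM] /andP[j0 jM]; rewrite /s2 /s3 /P qN.
    have [_ h2 h3] := sph (q i) (q j) (q01 _ (ltnW iM)) (q01 _ (ltnW jM)).
    by rewrite h2 ?h3 ?q12// !qh.
apply: (@cup_product_boundary _ _ _ _ 0 0) => [k i j kM iM jM|k i j kM iM jM kij].
  apply: contrapT => no.
  have n1 : ~ cst_on_cell s1 k i j by move=> c; apply: no; apply: Or31.
  have n2 : ~ cst_on_cell s2 k i j by move=> c; apply: no; apply: Or32.
  have n3 : ~ cst_on_cell s3 k i j by move=> c; apply: no; apply: Or33.
  suff : m p0 < m p0 by rewrite ltxx.
  apply: le_lt_trans (minm _ (mem_set (KP _ _ _ (ltnW kM) (ltnW iM) (ltnW jM)))) _.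
  have -> : m p0 = m p0 / 3 + m p0 / 3 + m p0 / 3 by lra.
  apply: ltrD; first apply: ltrD.
  - apply: small n1 => // k' i' j' s12; apply: norm_le_sign_change; apply: contra_neq s12.
    by rewrite /s1 => ->.
  - apply: small n2 => // k' i' j' s12; apply: norm_le_sign_change; apply: contra_neq s12.
    by rewrite /s2 !ltNge => ->.
  - apply: small n3 => // k' i' j' s12; apply: norm_le_sign_change; apply: contra_neq s12.
    by rewrite /s3 !ltNge => ->.
have [] := bnd _ (KP _ _ _ kM iM jM).
  have qN : q (2 * M)%N = 1 by rewrite /q divff// gt_eqF.
  have q0 : q 0%N = 0 by rewrite /q mul0r.
  rewrite /P /= -q0 -qN.
  by case/or4P: kij => [||| /orP[]] /eqP ->; rewrite eqxx ?orbT.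
by rewrite /s2 /s3 !leNgt => /negbTE-> /negbTE->.
Qed.
End Degree.

(** * Logarithms of nonvanishing functions on a cube *)

Lemma continuous_comp_fun (T U W : topologicalType) (g : U -> W) (f : T -> U) :
  continuous g -> continuous f -> continuous (fun x => g (f x)).
Proof. by move=> cg cf x; apply: continuous_comp; [exact: cf|exact: cg]. Qed.

Section FieldValued.
Variables (T : topologicalType) (K : numFieldType).
Implicit Types f g : T -> K.

Lemma continuousD_fun f g :
  continuous f -> continuous g -> continuous (fun x => f x + g x).
Proof. by move=> cf cg x; apply: cvgD; [exact: cf|exact: cg]. Qed.

Lemma continuousN_fun f : continuous f -> continuous (fun x => - f x).
Proof. by move=> cf x; apply: cvgN; exact: cf. Qed.

Lemma continuousM_fun f g :
  continuous f -> continuous g -> continuous (fun x => f x * g x).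
Proof. by move=> cf cg x; apply: cvgM; [exact: cf|exact: cg]. Qed.

Lemma continuousV_fun f : (forall x, f x != 0) -> continuous f ->
  continuous (fun x => (f x)^-1).
Proof. by move=> f0 cf x; apply: cvgV; [exact: f0|exact: cf]. Qed.

End FieldValued.

Lemma continuous_max_fun (R : realType) (T : topologicalType) (f g : T -> R) :
  continuous f -> continuous g -> continuous (fun x => Order.max (f x) (g x)).
Proof. by move=> cf cg x; exact: (continuous_max (cf x) (cg x)). Qed.

Lemma continuous_min_fun (R : realType) (T : topologicalType) (f g : T -> R) :
  continuous f -> continuous g -> continuous (fun x => Order.min (f x) (g x)).
Proof. by move=> cf cg x; exact: (continuous_min (cf x) (cg x)). Qed.

Lemma complex_reB (R : realType) (z w : R[i]) : re (z - w) = re z - re w.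
Proof. by case: z w => [a b] [c d]. Qed.

Lemma complex_imB (R : realType) (z w : R[i]) : im (z - w) = im z - im w.
Proof. by case: z w => [a b] [c d]. Qed.

Section ComplexContinuity.
Variables (R : realType) (T : topologicalType).
Implicit Types f g : T -> R[i].

(** The norm of [R[i]] takes its values in [R[i]], so the radius is itself a complex number; the
    order on [R[i]] forces it to be real. This form trades discs for squares and keeps later
    estimates within [R]. *)
Lemma nbhs_complexP (z : R[i]) (A : set R[i]) :
  nbhs z A <-> exists2 e : R, 0 < e & forall w, 
    `|re w - re z| < e -> `|im w - im z| < e -> A w.
Proof.
split.
  move=> /nbhs_normP[e /= e0 sub].
  have [eIm eRe] : im e = 0 /\ 0 < re e.
    by move: e0; rewrite ltcE /= => /andP[/eqP].
  exists (re e / 2); first by rewrite divr_gt0.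
  move=> w wr wi; apply: sub; rewrite /ball_ /=.
  rewrite normc_def ltcE /= eIm eqxx /= -(@ger0_norm _ (re e)) ?(ltW eRe)//.
  rewrite -sqrtr_sqr ltr_sqrt ?exprn_gt0//.
  case: z w wr wi => [zr zi] [wr wi] /=; rewrite !ltr_norml => h1 h2; nra.
move=> [e e0 sub]; apply/nbhs_normP; exists e%:C; first by rewrite /= ltcE /= eqxx.
move=> w /=; rewrite normc_def ltcE /= eqxx /= => lt.
have lt2 : re (z - w) ^+ 2 + im (z - w) ^+ 2 < e ^+ 2.
  by rewrite -(@ltr_sqrt _ _ (e ^+ 2)) ?exprn_gt0// [X in _ < X]sqrtr_sqr gtr0_norm.
have := sqr_ge0 (re z - re w); have := sqr_ge0 (im z - im w).
move: lt2; rewrite complex_reB complex_imB => lt2 hi hr.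
by apply: sub; rewrite -ltr_sqr ?nnegrE ?normr_ge0 ?(ltW e0)// real_normK ?num_real//; nra.
Qed.

Lemma continuous_complexP f :
  continuous f <-> continuous (re \o f) /\ continuous (im \o f).
Proof.
split=> [cf|[cr ci]].
  split=> x; apply/cvgrPdist_lt => e e0.
    have /(cf x) h : nbhs (f x) [set w | `|re w - re (f x)| < e].
      by apply/nbhs_complexP; exists e.
    by near=> y; rewrite /= distrC; near: y; exact: h.
  have /(cf x) h : nbhs (f x) [set w | `|im w - im (f x)| < e].
    by apply/nbhs_complexP; exists e.
  by near=> y; rewrite /= distrC; near: y; exact: h.
move=> x A /nbhs_complexP[e e0 sub].
have /cvgrPdist_lt/(_ e e0) h1 := cr x.
have /cvgrPdist_lt/(_ e e0) h2 := ci x.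
near=> y; apply: sub; rewrite distrC; near: y; [exact: h1|exact: h2].
Unshelve. all: by end_near. Qed.

End ComplexContinuity.

(** * The complex exponential and the principal logarithm *)

Section ComplexExponential.
Variable R : realType.
Implicit Types z w : R[i].

Definition cexp z : R[i] :=
  (expR (re z) * cos (im z)) +i* (expR (re z) * sin (im z)).

Lemma cexpD z w : cexp (z + w) = cexp z * cexp w.
Proof.
case: z w => [a b] [c d]; rewrite /cexp /=; apply/eqP; rewrite eq_complex /=.
by rewrite expRD cosD sinD; apply/andP; split; apply/eqP; ring.
Qed.

Lemma cexp0 : cexp 0 = 1.
Proof. by rewrite /cexp /= expR0 cos0 sin0 mulr1 mulr0. Qed.

Lemma cexp_neq0 z : cexp z != 0.
Proof.
apply/eqP => z0; have := cexpD z (- z); rewrite subrr cexp0 z0 mul0r.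
by move/eqP; rewrite oner_eq0.
Qed.

Lemma cexpB z w : cexp (z - w) = cexp z / cexp w.
Proof. by rewrite -[z in RHS](subrK w) [in RHS]cexpD mulfK ?cexp_neq0. Qed.

Lemma cexp_eq1 z : cexp z = 1 -> re z = 0 /\ cos (im z) = 1.
Proof.
move=> /eqP; rewrite eq_complex /= => /andP[/eqP h1 /eqP h2].
have e0 := expR_gt0 (re z); have cs := cos2Dsin2 (im z).
have s0 : sin (im z) = 0.
  by move/eqP: h2; rewrite mulf_eq0 gt_eqF//= => /eqP.
have c2 : cos (im z) ^+ 2 = 1 by rewrite -[RHS]cs s0 expr0n addr0.
have c0 : 0 < cos (im z) by rewrite -(pmulr_rgt0 _ e0) h1.
have c1 : cos (im z) = 1 by apply/eqP; rewrite -(@eqrXn2 _ 2)// ?ltW// c2 expr1n.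
by split => //; apply: expR_inj; rewrite expR0 -h1 c1 mulr1.
Qed.

Lemma continuous_cexp : continuous cexp.
Proof.
(* Applied to the identity, the criterion gives the continuity of the real and imaginary parts
   themselves. *)
have /continuous_complexP[cr ci] : continuous (@id R[i]) by move=> x; exact: cvg_id.
have ce : continuous (fun z => expR (re z)).
  by apply: continuous_comp_fun cr; exact: continuous_expR.
apply/continuous_complexP; split; apply: (continuousM_fun ce).
  by apply: continuous_comp_fun ci; exact: continuous_cos.
by apply: continuous_comp_fun ci; exact: continuous_sin.
Qed.

(* The principal logarithm, meaningful on the right half-plane only. *)
Definition plog z : R[i] :=
  ln (Num.sqrt (re z ^+ 2 + im z ^+ 2)) +i* atan (im z / re z).

Lemma plogK z : 0 < re z -> cexp (plog z) = z.
Proof.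
case: z => [x y] /= x0; rewrite /plog /cexp /=.
have n0 : 0 < Num.sqrt (x ^+ 2 + y ^+ 2).
  by rewrite sqrtr_gt0 ltr_wpDr ?sqr_ge0// exprn_gt0.
have c0 : cos (atan (y / x)) != 0 by rewrite gt_eqF// cos_gt0_pihalf// atan_gtNpi2 atan_ltpi2.
have sE : sin (atan (y / x)) = y / x * cos (atan (y / x)).
  by apply: (mulIf (invr_neq0 c0)); rewrite mulfK//; exact: (atanK (y / x)).
have key : Num.sqrt (x ^+ 2 + y ^+ 2) * cos (atan (y / x)) = x.
  rewrite cos_atan.
  have -> : x ^+ 2 + y ^+ 2 = x ^+ 2 * (1 + (y / x) ^+ 2) by field; rewrite gt_eqF.
  rewrite sqrtrM ?sqr_ge0// sqrtr_sqr gtr0_norm// mulfK//.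
  by rewrite sqrtr_eq0 -ltNge ltr_pwDl ?sqr_ge0.
rewrite lnK ?posrE// key sE mulrCA key; congr (_ +i* _).
by rewrite divfK// gt_eqF.
Qed.

(** A rotation by a multiple of a quarter turn brings [z] into the right half-plane, where [plog]
    inverts [cexp]. *)
Lemma cexp_surj z : z != 0 -> exists w, cexp w = z.
Proof.
have trans (u a : R[i]) : cexp u * a = z -> 0 < re a -> exists w, cexp w = z.
  by move=> <- a0; exists (u + plog a); rewrite cexpD plogK.
case: z trans => [x y] trans z0.
have [x0|x0] := ltrP 0 x; first by apply: (trans 0 (x +i* y)) => //; rewrite cexp0 mul1r.
have [y0|y0|y0] := ltrgtP y 0.
- apply: (trans (0 +i* - (pi / 2)) ((- y) +i* x)); last by rewrite /= oppr_gt0.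
  rewrite /cexp /= expR0 cosN sinN cos_pihalf sin_pihalf; apply/eqP.
  by rewrite eq_complex /=; apply/andP; split; apply/eqP; ring.
- apply: (trans (0 +i* (pi / 2)) (y +i* - x)) => //.
  rewrite /cexp /= expR0 cos_pihalf sin_pihalf; apply/eqP.
  by rewrite eq_complex /=; apply/andP; split; apply/eqP; ring.
- apply: (trans (0 +i* pi) ((- x) +i* - y)).
    rewrite /cexp /= expR0 cospi sinpi; apply/eqP.
    by rewrite eq_complex /=; apply/andP; split; apply/eqP; ring.
  rewrite /= oppr_gt0 lt_neqAle x0 andbT; apply: contra z0 => /eqP->.
  by rewrite y0 eq_complex /= eqxx.
Qed.

Lemma continuous_plog (T : topologicalType) (f : T -> R[i]) :
  continuous f -> (forall x, 0 < re (f x)) -> continuous (plog \o f).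
Proof.
move=> /continuous_complexP[cr ci] f0; apply/continuous_complexP.
have n0 x : 0 < re (f x) ^+ 2 + im (f x) ^+ 2.
  by rewrite ltr_wpDr ?sqr_ge0// exprn_gt0.
split.
  have cn : continuous (fun x => Num.sqrt (re (f x) ^+ 2 + im (f x) ^+ 2)).
    apply: (@continuous_comp_fun _ _ _ Num.sqrt); first exact: sqrt_continuous.
    by apply: continuousD_fun; apply: continuousM_fun.
  move=> x; apply: (continuous_comp (cn x)).
  by apply: continuous_ln; rewrite sqrtr_gt0.
apply: (@continuous_comp_fun _ _ _ (@atan R)) => [x|].
  exact: continuous_atan.
apply: continuousM_fun => //; apply: continuousV_fun => // x.
by rewrite gt_eqF.
Qed.

End ComplexExponential.

Section LogLift.
Variable R : realType.
Local Notation V := (R * R * R)%type.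
Implicit Types (p q : V) (z w : R[i]).

Lemma continuous_coord1 : continuous (fun p : V => p.1.1).
Proof. by apply: (@continuous_comp_fun _ _ _ fst fst) => x; exact: cvg_fst. Qed.

Lemma continuous_coord2 : continuous (fun p : V => p.1.2).
Proof.
by apply: (@continuous_comp_fun _ _ _ snd fst) => x; [exact: cvg_snd|exact: cvg_fst].
Qed.

Lemma continuous_coord3 : continuous (fun p : V => p.2).
Proof. by move=> x; exact: cvg_snd. Qed.

(** The retraction of the line onto the unit interval. It allows maps on the box to be treated as
    maps on all of $R^3$, without subspace topologies. *)
Definition clamp01 (t : R) : R := Order.max 0 (Order.min t 1).

Lemma clamp01_itv t : 0 <= clamp01 t <= 1.
Proof. by rewrite /clamp01 le_max lexx /= ge_max ler01 ge_min lexx orbT. Qed.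

Lemma clamp01_id t : 0 <= t <= 1 -> clamp01 t = t.
Proof. by move=> /andP[t0 t1]; rewrite /clamp01 min_l// max_r. Qed.

Lemma continuous_clamp01 : continuous clamp01.
Proof.
apply: continuous_max_fun; first by move=> t; exact: cvg_cst.
by apply: continuous_min_fun => t; [exact: cvg_id|exact: cvg_cst].
Qed.

(** The retraction onto the box followed by a contraction of ratio [a] towards the corner
    [(0, 0, 0)]. *)
Definition scaled_clamp (a : R) p : V :=
  (a * clamp01 p.1.1, a * clamp01 p.1.2, a * clamp01 p.2).

Lemma continuous_scaled_clamp a : continuous (scaled_clamp a).
Proof.
have term (f : V -> R) : continuous f -> continuous (fun p => a * clamp01 (f p)).
  move=> cf; apply: (continuousM_fun (@cst_continuous _ _ a)).
  exact: continuous_comp_fun continuous_clamp01 cf.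
exact: continuous_pair (continuous_pair (term _ continuous_coord1)
  (term _ continuous_coord2)) (term _ continuous_coord3).
Qed.

Lemma box_scaled_clamp a p : 0 <= a <= 1 -> box (scaled_clamp a p).
Proof.
move=> /andP[a0 a1]; apply/boxP; split=> /=;
  move: (clamp01_itv p.1.1) (clamp01_itv p.1.2) (clamp01_itv p.2);
  by move=> /andP[? ?] /andP[? ?] /andP[? ?]; rewrite mulr_ge0// mulr_ile1.
Qed.

Lemma ball_scaled_clamp a b d p : `|a - b| < d ->
  ball (scaled_clamp a p) d (scaled_clamp b p).
Proof.
move=> abd; have near01 t : `|a * clamp01 t - b * clamp01 t| < d.
  have /andP[t0 t1] := clamp01_itv t.
  by rewrite -mulrBl normrM (ger0_norm t0); apply: le_lt_trans abd; rewrite ler_piMr.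
by split; [split|]; exact: near01.
Qed.

Lemma scaled_clamp1 p : box p -> scaled_clamp 1 p = p.
Proof.
by case: p => [[t x] y] /boxP[*]; rewrite /scaled_clamp !mul1r !clamp01_id.
Qed.

(** With $z = a + ib$, the sign of [re (w / z)] is that of the scalar product of [w] and [z]. It
    differs from $|z|^2$ by at most $(|a|+|b|)e \le (|a|+|b|)^2/3 \le 2|z|^2/3$. *)
Lemma re_div_gt0 z w (e : R) : `|re z - re w| < e -> `|im z - im w| < e ->
  3 * e <= `|re z| + `|im z| -> 0 < re (w / z).
Proof.
case: z w => [a b] [c d] /= ac bd e2.
have e0 : 0 < e by apply: le_lt_trans ac.
have n0 : 0 < a ^+ 2 + b ^+ 2.
  rewrite lt_neqAle addr_ge0 ?sqr_ge0// andbT eq_sym paddr_eq0 ?sqr_ge0//.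
  rewrite !sqrf_eq0; apply/negP => /andP[/eqP a0 /eqP b0].
  by move: e2; rewrite a0 b0 normr0; lra.
have -> : c * (a / (a ^+ 2 + b ^+ 2)) - d * - (b / (a ^+ 2 + b ^+ 2)) =
   (c * a + d * b) / (a ^+ 2 + b ^+ 2).
  by field; rewrite gt_eqF.
rewrite divr_gt0//.
have hc : - (`|a| * e) <= (c - a) * a.
  rewrite -[X in _ <= X]opprK lerN2 -mulNr opprB; apply: le_trans (ler_norm _) _.
  by rewrite normrM mulrC ler_wpM2l// ltW.
have hd : - (`|b| * e) <= (d - b) * b.
  rewrite -[X in _ <= X]opprK lerN2 -mulNr opprB; apply: le_trans (ler_norm _) _.
  by rewrite normrM mulrC ler_wpM2l// ltW.
have ha : a ^+ 2 = `|a| ^+ 2 by rewrite real_normK ?num_real.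
have hb : b ^+ 2 = `|b| ^+ 2 by rewrite real_normK ?num_real.
have key : 0 < `|a| ^+ 2 + `|b| ^+ 2 - (`|a| + `|b|) * e.
  by have := sqr_ge0 (`|a| - `|b|); nra.
by move: key; rewrite -ha -hb; lra.
Qed.

(** The box is contracted to a corner, where [g] becomes constant, and expanded again in [n] small
    steps. Each step multiplies the value of [g] by a factor in the right half-plane, and the
    principal logarithm of this factor is added to the lift. *)
Lemma log_lift (g : V -> R[i]) : continuous g -> (forall p, g p != 0) ->
  exists2 L : V -> R[i], continuous L & forall p, box p -> cexp (L p) = g p.
Proof.
move=> cg g0; have [cr ci] := (continuous_complexP g).1 cg.
pose m p := `|re (g p)| + `|im (g p)|.
have cm : continuous m.
  by apply: continuousD_fun; apply: continuous_comp_fun; try exact: norm_continuous.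
have box0 : @box R !=set0 by exists (0, 0, 0); apply/boxP; rewrite /= lexx ler01.
have [p0 p0K minm] :=
  compact_EVT_min box0 (@compact_box R) (continuous_subspaceT cm).
have m0 : 0 < m p0.
  rewrite lt_neqAle eq_sym addr_ge0// andbT paddr_eq0// !normr_eq0.
  by have := g0 p0; rewrite eq_complex.
(* The divisor 3 is the constant of [re_div_gt0]. *)
have e0 : 0 < m p0 / 3 by rewrite divr_gt0.
have [d d0 unif] :=
  compact_uniform_continuity (@compact_box R) (continuous_pair cr ci) e0.
pose n := Num.bound d^-1.
have nd : d^-1 < n%:R by apply: archi_boundP; rewrite invr_ge0 ltW.
have n0 : 0 < n%:R :> R by apply: lt_trans nd; rewrite invr_gt0.
have step k : (k <= n)%N -> exists2 L : V -> R[i], continuous L &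
    forall p, cexp (L p) = g (scaled_clamp (k%:R / n%:R) p).
  elim: k => [_|k IH kn].
    have [l lE] := cexp_surj (g0 (0, 0, 0)).
    exists (cst l); first exact: cst_continuous.
    by move=> p; rewrite /= lE /scaled_clamp !mul0r.
  have [L cL LE] := IH (ltnW kn).
  have ratio_gt0 (p : V) : 0 < re (g (scaled_clamp (k.+1%:R / n%:R) p) /
                            g (scaled_clamp (k%:R / n%:R) p)).
    have kK : box (scaled_clamp (k%:R / n%:R) p).
      by apply: box_scaled_clamp; rewrite divr_ge0//= ler_pdivrMr// mul1r ler_nat ltnW.
    have [] := unif _ (scaled_clamp (k.+1%:R / n%:R) p) kK.
      apply: ball_scaled_clamp; rewrite -mulrBl -natr1 opprD addrA subrr sub0r.
      by rewrite mulN1r normrN gtr0_norm ?invr_gt0// invf_plt.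
    move=> hr hi; apply: re_div_gt0 hr hi _; rewrite mulrC divfK//.
    by apply: minm; exact: mem_set.
  have cgk j : continuous (fun p => g (scaled_clamp (j%:R / n%:R) p)).
    exact: continuous_comp_fun cg (@continuous_scaled_clamp _).
  have cratio : continuous (fun p => g (scaled_clamp (k.+1%:R / n%:R) p) /
                                     g (scaled_clamp (k%:R / n%:R) p)).
    apply: (continuousM_fun (cgk _)); apply: (continuousV_fun _ (cgk k)) => p.
    exact: g0.
  exists (fun p => L p + plog (g (scaled_clamp (k.+1%:R / n%:R) p) /
                        g (scaled_clamp (k%:R / n%:R) p))).
    exact: (continuousD_fun cL (continuous_plog cratio ratio_gt0)).
  move=> p; rewrite cexpD plogK; last exact: ratio_gt0.
  by rewrite LE mulrC divfK.
have [L cL LE] := step n (leqnn n); exists L => // p pK.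
by rewrite LE divff ?gt_eqF// scaled_clamp1.
Qed.

End LogLift.

(** * Uniqueness of lifts and normalisation on the boundary of the box *)

Section LiftUniqueness.
Variable R : realType.
Local Notation V := (R * R * R)%type.
Implicit Types (p q : V).

(** If [f] increased from 0 to 1, it would take a value [v] with $f(0) < v \le f(0) + 1$. Then
    $\cos(v - f(0)) = 1$, which contradicts the injectivity of the cosine on $[0, \pi]$. A decrease
    is handled through $-f$. *)
Lemma cos_eq1_const (f : R -> R) : continuous f ->
  (forall t, 0 <= t <= 1 -> cos (f t) = 1) -> f 0 = f 1.
Proof.
have sin0 x : cos x = 1 -> sin x = 0 :> R.
  move=> c1; have := cos2Dsin2 x; rewrite c1 expr1n => /eqP.
  by rewrite -subr_eq0 addrAC subrr add0r sqrf_eq0 => /eqP.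
have noinc (g : R -> R) : continuous g ->
    (forall t, 0 <= t <= 1 -> cos (g t) = 1) -> g 0 < g 1 -> False.
  move=> cg g1 lt01; pose v := Order.min (g 1) (g 0 + 1).
  have v0 : g 0 < v by rewrite /v lt_min lt01 ltrDl ltr01.
  have v1 : v <= g 0 + 1 by rewrite /v ge_min lexx orbT.
  have [||c] := @IVT R g 0 1 v ler01.
  - exact: continuous_subspaceT.
  - by rewrite min_l ?max_r ?(ltW lt01)// (ltW v0)/= /v ge_min lexx.
  rewrite in_itv /= => c01 gc.
  have : cos (v - g 0) = 1.
    rewrite cosB -gc !g1 ?lexx ?ler01// !sin0 ?g1 ?lexx ?ler01//.
    by rewrite mulr0 addr0 mulr1.
  rewrite -cos0 => /cos_inj; rewrite !in_itv /= lexx pi_ge0 subr_ge0 (ltW v0) /=.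
  have pi1 : 1 <= pi :> R by apply: le_trans (pi_ge2 R); rewrite ler1n.
  have -> : v - g 0 <= pi by rewrite lerBlDl (le_trans v1)// lerD2l.
  by move=> /(_ isT isT); apply/eqP; rewrite subr_eq0 gt_eqF.
move=> cf f1; case: (ltgtP (f 0) (f 1)) => // lt01; exfalso.
  exact: noinc lt01.
apply: (noinc (fun t => - f t)); last by rewrite ltrN2.
  exact: continuousN_fun.
by move=> t t01; rewrite cosN f1.
Qed.

Definition segment3 p q (t : R) : V :=
  (p.1.1 + t * (q.1.1 - p.1.1), p.1.2 + t * (q.1.2 - p.1.2),
   p.2 + t * (q.2 - p.2)).

Lemma segment3_0 p q : segment3 p q 0 = p.
Proof. by case: p => [[? ?] ?]; rewrite /segment3 !mul0r !addr0. Qed.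

Lemma segment3_1 p q : segment3 p q 1 = q.
Proof.
by case: q => [[? ?] ?]; rewrite /segment3 !mul1r ![_ + (_ - _)]addrC !subrK.
Qed.

Lemma continuous_segment3 p q : continuous (segment3 p q).
Proof.
have ca (a b : R) : continuous (fun t : R => a + t * b).
  apply: continuousD_fun; first by move=> x; exact: cvg_cst.
  by apply: continuousM_fun => x; [exact: cvg_id|exact: cvg_cst].
exact: (continuous_pair (continuous_pair (ca _ _) (ca _ _)) (ca _ _)).
Qed.

Lemma box_segment3 p q t : box p -> box q -> 0 <= t <= 1 -> box (segment3 p q t).
Proof.
move=> /boxP[p1 p2 p3] /boxP[q1 q2 q3] t01; apply/boxP.
have conv (a b : R) : 0 <= a <= 1 -> 0 <= b <= 1 -> 0 <= a + t * (b - a) <= 1.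
  by move: t01 => /andP[? ?] /andP[? ?] /andP[? ?]; apply/andP; split; nra.
by split; exact: conv.
Qed.

(** The kernel of [cexp] is discrete, so a path that stays in it is constant. Applied to the
    difference of two logarithms, this gives uniqueness of lifts along segments. *)
Lemma lift_const (L : V -> R[i]) p q : continuous L ->
  (forall t, 0 <= t <= 1 -> cexp (L (segment3 p q t)) = 1) -> L p = L q.
Proof.
move=> cL L1.
have /continuous_complexP[_ ci] : continuous (fun t => L (segment3 p q t)).
  exact: continuous_comp_fun cL (@continuous_segment3 p q).
have := cos_eq1_const ci (fun t t01 => (cexp_eq1 (L1 t t01)).2).
rewrite /= segment3_0 segment3_1 => eqi.
have := (cexp_eq1 (L1 0 _)).1; have := (cexp_eq1 (L1 1 _)).1.
rewrite segment3_0 segment3_1 !lexx !ler01 => /(_ isT) r1 /(_ isT) r0.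
by apply/eqP; rewrite eq_complex r0 r1 eqi !eqxx.
Qed.

(* The part of the boundary of the box on which a null homotopy of a spheroid is constant. *)
Definition box_walls p : bool :=
  [|| p.1.1 == 0, p.1.2 == 0, p.1.2 == 1, p.2 == 0 | p.2 == 1].

(** Any lift can be shifted by an element of the kernel of [cexp] so as to agree with [l] at one
    corner of the top face. Segments inside the top face and inside the walls carry the agreement to
    all points of these faces. *)
Lemma null_homotopy_lift (g : V -> R[i]) (l : R * R -> R[i]) (c : R[i]) :
  continuous g -> continuous l -> (forall p, g p != 0) ->
  (forall x y : R, 0 <= x <= 1 -> 0 <= y <= 1 -> g (1, x, y) = cexp (l (x, y))) ->
  (forall p, box p -> box_walls p -> g p = cexp c) -> l (0, 0) = c ->
  exists L : V -> R[i], [/\ continuous L,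
    forall p, box p -> cexp (L p) = g p,
    forall x y : R, 0 <= x <= 1 -> 0 <= y <= 1 -> L (1, x, y) = l (x, y) &
    forall p, box p -> box_walls p -> L p = c].
Proof.
move=> cg cl g0 gl gc l0; have [L0 cL0 L0E] := log_lift cg g0.
have box1 (x y : R) : 0 <= x <= 1 -> 0 <= y <= 1 -> box (1, x, y).
  by move=> *; apply/boxP; rewrite /= lexx ler01.
have i0 : (0 : R) <= (0 : R) <= (1 : R) by rewrite lexx ler01.
have i1 : (0 : R) <= (1 : R) <= (1 : R) by rewrite lexx ler01.
pose k := L0 (1, 0, 0) - c.
have k1 : cexp k = 1.
  by rewrite cexpB L0E ?box1// gl// l0 divff ?cexp_neq0.
pose L p := L0 p - k.
have LE p : box p -> cexp (L p) = g p.
  by move=> pK; rewrite /L cexpB k1 divr1 L0E.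
have cL : continuous L.
  exact: continuousD_fun cL0 (@cst_continuous _ _ (- k)).
exists L; split => //.
  move=> x y x01 y01; apply/eqP; rewrite -subr_eq0; apply/eqP.
  pose D p := L p - l (p.1.2, p.2).
  have cD : continuous D.
    apply: (continuousD_fun cL); apply: continuousN_fun.
    apply: (continuous_comp_fun cl).
    exact: continuous_pair (@continuous_coord2 R) (@continuous_coord3 R).
  have <- : D (1, 0, 0) = 0 by rewrite /D /L /= l0 /k opprB addrCA subrr addr0 subrr.
  apply: esym; apply: (@lift_const D) => // t t01.
  have := box_segment3 (box1 0 0 i0 i0) (box1 x y x01 y01) t01.
  rewrite /D cexpB => sK; rewrite LE//; move: sK => /boxP.
  rewrite /segment3 /= !subrr !mulr0 !addr0 => -[_ sx sy].
  by rewrite gl// divff ?cexp_neq0.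
have cE : continuous (fun p => L p - c).
  exact: continuousD_fun cL (@cst_continuous _ _ (- c)).
have walls p q : box p -> box q ->
    (forall t, 0 <= t <= 1 -> box_walls (segment3 p q t)) -> L p = L q.
  move=> pK qK w; apply: (@addIr _ (- c)); apply: (lift_const cE) => t t01.
  have sK := box_segment3 pK qK t01.
  by rewrite cexpB LE// (gc _ sK (w t t01)) divff ?cexp_neq0.
have L1 : L (1, 0, 0) = c by rewrite /L /k opprB addrCA subrr addr0.
have L00 : L (0, 0, 0) = c.
  rewrite -L1; apply: walls; [by apply/boxP|exact: box1|] => t _.
  by rewrite /box_walls /segment3 /= !subrr !mulr0 !addr0 eqxx !orbT.
case=> [[t x] y] pK w; have := pK => /boxP[/= t01 x01 y01].
have K0 (a b : R) : 0 <= a <= 1 -> 0 <= b <= 1 -> box (0, a, b).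
  by move=> *; apply/boxP.
(* A point of the walls is first dropped to the floor, along a segment that stays in the walls, and
   then moved within the floor to the corner [(0, 0, 0)]. *)
transitivity (L (0, x, y)).
  apply: (walls (t, x, y) (0, x, y) pK (K0 _ _ x01 y01)) => s _.
  rewrite /box_walls /segment3 /= !subrr !mulr0 !addr0.
  case/orP: w => /= [/eqP->|->]; last by rewrite orbT.
  by rewrite subrr mulr0 addr0 eqxx.
rewrite -L00; apply: (walls (0, x, y) (0, 0, 0) (K0 _ _ x01 y01) (K0 _ _ i0 i0)) => s _.
by rewrite /box_walls /segment3 /= !subrr !mulr0 !addr0 eqxx.
Qed.

End LiftUniqueness.

(** * An essential sphere in the complement of three generic lines *)

Section Directions.
Variable R : realType.
Implicit Types (q : R * R) (i : 'I_3).

Definition radius q : R := Order.max `|2 * q.1 - 1| `|2 * q.2 - 1|.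

(** A map from the square to $R^3$ minus the origin, equal to $(-1, 0, 0)$ at the centre and to $(1,
    0, 0)$ on the whole boundary. Its first coordinate vanishes where [radius] is $1/2$, and there
    the other two run once around a small square. *)
Definition bump i q : R :=
  match val i with
  | 0%N => 2 * radius q - 1
  | 1%N => (2 * q.1 - 1) * (1 - radius q)
  | _ => (2 * q.2 - 1) * (1 - radius q)
  end.

Definition bump_norm q : R :=
  Order.max `|bump 0 q| (Order.max `|bump 1 q| `|bump 2 q|).

(** Division by the sup norm puts the values on the surface of the cube $[-1,1]^3$, around which the
    square, with its boundary collapsed to a point, is wrapped once. *)
Definition dir i q : R := bump i q / bump_norm q.

Lemma bump_norm_ge i q : `|bump i q| <= bump_norm q.
Proof.
by elim/ord3_ind: i; rewrite /bump_norm !le_max lexx ?orbT.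
Qed.

Lemma bump_norm_gt0 q : 0 < bump_norm q.
Proof.
rewrite lt_neqAle (le_trans (normr_ge0 _) (bump_norm_ge 0 q)) andbT eq_sym.
apply/eqP => n0.
have b0 i : bump i q = 0.
  by apply/eqP; rewrite -normr_le0 -n0 bump_norm_ge.
have r2 : radius q = 1 / 2 by have := b0 0; rewrite /bump /=; lra.
have x0 : 2 * q.1 - 1 = 0 by have := b0 1; rewrite /bump /= r2; lra.
have y0 : 2 * q.2 - 1 = 0 by have := b0 2; rewrite /bump /= r2; lra.
by move: r2; rewrite /radius x0 y0 normr0 maxxx; lra.
Qed.

Lemma dir_norm_eq1 q : exists i, `|dir i q| = 1.
Proof.
have n0 := bump_norm_gt0 q.
have h i : bump_norm q = `|bump i q| -> `|dir i q| = 1.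
  by move=> e; rewrite normrM normfV (gtr0_norm n0) -e divff// gt_eqF.
rewrite {1}/bump_norm in h.
case: (leP `|bump 0 q| (Order.max `|bump 1 q| `|bump 2 q|)) => h0.
  case: (leP `|bump 1 q| `|bump 2 q|) => h1.
    by exists 2; apply: h; rewrite max_r// max_r.
  by exists 1; apply: h; rewrite max_r// max_l// ltW.
by exists 0; apply: h; rewrite max_l// ltW.
Qed.

Lemma dir_gt0 i q : (0 < dir i q) = (0 < bump i q).
Proof. by rewrite /dir pmulr_lgt0// invr_gt0 bump_norm_gt0. Qed.

Lemma continuous_bump i : continuous (bump i).
Proof.
have c k : continuous (cst k : R * R -> R) by exact: cst_continuous.
have c1 : continuous (fun q : R * R => 2 * q.1 - 1).
  apply: (continuousD_fun _ (c (- 1))); apply: (continuousM_fun (c 2)) => x.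
  exact: cvg_fst.
have c2 : continuous (fun q : R * R => 2 * q.2 - 1).
  apply: (continuousD_fun _ (c (- 1))); apply: (continuousM_fun (c 2)) => x.
  exact: cvg_snd.
have cn (f : R * R -> R) : continuous f -> continuous (fun q => `|f q|).
  by move=> cf; exact: continuous_comp_fun (@norm_continuous _ _) cf.
have cr : continuous radius := continuous_max_fun (cn _ c1) (cn _ c2).
have cr' := continuousD_fun (c 1) (continuousN_fun cr).
elim/ord3_ind: i; rewrite /bump /=.
- exact: continuousD_fun (continuousM_fun (c 2) cr) (c (- 1)).
- exact: continuousM_fun c1 cr'.
- exact: continuousM_fun c2 cr'.
Qed.

Lemma continuous_dir i : continuous (dir i).
Proof.
have cn (f : R * R -> R) : continuous f -> continuous (fun q => `|f q|).
  by move=> cf; exact: continuous_comp_fun (@norm_continuous _ _) cf.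
apply: continuousM_fun; first exact: continuous_bump.
apply: continuousV_fun; first by move=> x; rewrite gt_eqF// bump_norm_gt0.
apply: continuous_max_fun; first exact/cn/continuous_bump.
by apply: continuous_max_fun; exact/cn/continuous_bump.
Qed.

Lemma dir0_le0 (x y : R) : (dir 0 (x, y) <= 0) =
  (1 / 4 <= x <= 3 / 4) && (1 / 4 <= y <= 3 / 4).
Proof.
rewrite leNgt dir_gt0 -leNgt /bump /= /radius.
have half (z : R) : (`|2 * z - 1| <= 1 / 2) = (1 / 4 <= z <= 3 / 4).
  by rewrite ler_norml; apply/andP/andP => -[? ?]; split; lra.
rewrite -!half -ge_max; apply/idP/idP; lra.
Qed.

Lemma radius_lt1 (x y : R) : 0 < x < 1 -> 0 < y < 1 -> radius (x, y) < 1.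
Proof.
by rewrite /radius gt_max !ltr_norml => /andP[? ?] /andP[? ?]; apply/andP; split;
  apply/andP; split => /=; lra.
Qed.

Lemma dir1_gt0 (x y : R) : 0 < x < 1 -> 0 < y < 1 ->
  (0 < dir 1 (x, y)) = (1 / 2 < x).
Proof.
move=> x01 y01; have := radius_lt1 x01 y01 => r1.
rewrite dir_gt0 /bump /= pmulr_lgt0 ?subr_gt0//; apply/idP/idP; lra.
Qed.

Lemma dir2_gt0 (x y : R) : 0 < x < 1 -> 0 < y < 1 ->
  (0 < dir 2 (x, y)) = (1 / 2 < y).
Proof.
move=> x01 y01; have := radius_lt1 x01 y01 => r1.
rewrite dir_gt0 /bump /= pmulr_lgt0 ?subr_gt0//; apply/idP/idP; lra.
Qed.

Lemma dir_boundary (x y : R) i : 0 <= x <= 1 -> 0 <= y <= 1 ->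
  [|| x == 0, x == 1, y == 0 | y == 1] -> dir i (x, y) = (i == 0)%:R.
Proof.
move=> x01 y01 b.
have r1 : radius (x, y) = 1.
  have le1 (z : R) : 0 <= z <= 1 -> `|2 * z - 1| <= 1.
    by move=> /andP[? ?]; rewrite ler_norml; apply/andP; split; lra.
  have e0 : `|2 * 0 - 1| = 1 :> R by rewrite mulr0 sub0r normrN1.
  have e1 : `|2 * 1 - 1| = 1 :> R by rewrite (_ : 2 * 1 - 1 = 1) ?normr1//; lra.
  rewrite /radius /=; case/or4P: b => /eqP->; rewrite ?e0 ?e1;
    by [rewrite max_l// le1|rewrite max_r// le1].
have bE j : bump j (x, y) = (j == 0)%:R.
  elim/ord3_ind: j; rewrite /bump /= r1 ?subrr ?mulr0 //; lra.
rewrite /dir bE /bump_norm !bE /= normr1 normr0 maxxx max_l ?ler01//.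
by rewrite divr1.
Qed.

End Directions.

Section Sphere.
Variable R : realType.
Local Notation V := (R * R * R)%type.
Implicit Types (q : R * R) (i : 'I_3).

Definition dcos i q : R := cos (pi * dir i q).
Definition dsin i q : R := sin (pi * dir i q).
(** As [dir] has values in $[-1,1]$, this is positive exactly where $|$[dir i q]$| > 1/2$. The
    quotients [share] form a partition of unity. *)
Definition weight i q : R := Order.max 0 (- dcos i q).
Definition total q : R := weight 0 q + weight 1 q + weight 2 q.
Definition share i q : R := weight i q / total q.
(** [rest_re] and [rest_im] are the two parts of what is missing from the sum 1 when the coordinates
    follow the circles $-e^{i\pi d}/10$, where $d$ is the respective [dir]. *)
Definition rest_re q : R := 1 + 1 / 10 * (dcos 0 q + dcos 1 q + dcos 2 q).
Definition rest_im q : R := 1 / 10 * (dsin 0 q + dsin 1 q + dsin 2 q).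

(* A 2-sphere in the complement of the three lines [a = 0], [b = 0], [c = 0] of
   the plane [a + b + c = 1]: each coordinate turns around [0] on a small circle
   except where its argument is near [0]; there it may absorb the rest of the sum. *)
Definition sphere i q : R[i] :=
  (share i q * rest_re q - 1 / 10 * dcos i q) +i*
  (share i q * rest_im q - 1 / 10 * dsin i q).

(** This is [- sphere i q] turned back by the angle [pi * dir i q]. It stays in the right
    half-plane, so [sphere_log] is a continuous logarithm of [- sphere i q] whose imaginary part is
    within $\pi/2$ of [pi * dir i q]. *)
Definition sphere_rot i q : R[i] :=
  (1 / 10 - share i q * (rest_re q * dcos i q + rest_im q * dsin i q)) +i*
  (share i q * (rest_re q * dsin i q - rest_im q * dcos i q)).

Definition sphere_log i q : R[i] := plog (sphere_rot i q) + 0 +i* (pi * dir i q).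

Lemma weight_ge0 i q : 0 <= weight i q.
Proof. by rewrite /weight le_max lexx. Qed.

(** A coordinate with [dir] equal to $1$ or $-1$, which exists by [dir_norm_eq1], has weight 1. *)
Lemma total_ge1 q : 1 <= total q.
Proof.
have [i ni] := dir_norm_eq1 q.
have wi : weight i q = 1.
  rewrite /weight /dcos.
  suff -> : cos (pi * dir i q) = -1 by rewrite opprK max_r.
  have [ge0|lt0] := ger0P (dir i q); first by rewrite -(ger0_norm ge0) ni mulr1 cospi.
  by rewrite -(opprK (dir i q)) -(ltr0_norm lt0) ni mulrN1 cosN cospi.
have := (weight_ge0 0 q, weight_ge0 1 q, weight_ge0 2 q) => -[[w0 w1] w2].
by rewrite /total; elim/ord3_ind: i wi {ni} => ->; lra.
Qed.

Lemma share_ge0 i q : 0 <= share i q.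
Proof. by rewrite divr_ge0 ?weight_ge0// (le_trans ler01)// total_ge1. Qed.

Lemma share_le i q : share i q <= weight i q.
Proof.
have t1 := total_ge1 q; have t0 : 0 < total q by apply: lt_le_trans t1.
by rewrite ler_pdivrMr// ler_peMr// weight_ge0.
Qed.

Lemma share_sum q : share 0 q + share 1 q + share 2 q = 1.
Proof.
have t0 : total q != 0 by rewrite gt_eqF// (lt_le_trans ltr01)// total_ge1.
by rewrite /share -!mulrDl divff.
Qed.

Lemma dcos_bounds i q : -1 <= dcos i q <= 1.
Proof. by rewrite cos_geN1 cos_le1. Qed.

Lemma dsin_bounds i q : -1 <= dsin i q <= 1.
Proof. by rewrite sin_geN1 sin_le1. Qed.

Lemma share_le1 i q : share i q <= 1.
Proof.
apply: le_trans (share_le i q) _; rewrite /weight ge_max ler01 /=.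
by have /andP[? ?] := dcos_bounds i q; lra.
Qed.

Lemma rest_bounds q : (7 / 10 <= rest_re q <= 13 / 10) /\
  (- (3 / 10) <= rest_im q <= 3 / 10).
Proof.
have /andP[? ?] := dcos_bounds 0 q; have /andP[? ?] := dcos_bounds 1 q.
have /andP[? ?] := dcos_bounds 2 q.
have /andP[? ?] := dsin_bounds 0 q; have /andP[? ?] := dsin_bounds 1 q.
have /andP[? ?] := dsin_bounds 2 q.
by rewrite /rest_re /rest_im; split; apply/andP; split; lra.
Qed.

Lemma share_cases i q :
  share i q = 0 \/ 0 < share i q /\ share i q <= - dcos i q.
Proof.
have := share_ge0 i q; rewrite le_eqVlt => /orP[/eqP <-|s0]; first by left.
right; split => //; have := share_le i q; rewrite /weight.
by case: (leP 0 (- dcos i q)) => // _ h; lra.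
Qed.

Lemma sphere_sum q : sphere 0 q + sphere 1 q + sphere 2 q = 1.
Proof.
have := share_sum q; rewrite /sphere => s1; apply/eqP; rewrite eq_complex /=.
have s2 : share 2 q = 1 - share 0 q - share 1 q by rewrite -s1; ring.
by rewrite s2 /rest_re /rest_im; apply/andP; split; apply/eqP; field.
Qed.

Lemma sphere_bounds i q :
  [/\ - (1 / 10) <= re (sphere i q), re (sphere i q) <= 14 / 10,
      - (4 / 10) <= im (sphere i q) & im (sphere i q) <= 4 / 10].
Proof.
have [/andP[r1 r2] /andP[r3 r4]] := rest_bounds q.
have s0 := share_ge0 i q; have s1 := share_le1 i q.
have /andP[? ?] := dcos_bounds i q; have /andP[? ?] := dsin_bounds i q.
have : 0 <= share i q * rest_re q by rewrite mulr_ge0//; lra.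
have : share i q * rest_re q <= 13 / 10 by rewrite -[leRHS]mul1r ler_pM//; lra.
have : share i q * (3 / 10 - rest_im q) >= 0 by rewrite mulr_ge0//; lra.
have : share i q * (3 / 10 + rest_im q) >= 0 by rewrite mulr_ge0//; lra.
by rewrite /sphere /= => h1 h2 h3 h4; split; lra.
Qed.

(** If the share $s$ is nonzero, then $s \le -\cos$, and the bounds on the rest give a real part of
    at least $1/10 - 3s/10 + 7s^2/10$, a quadratic with negative discriminant. *)
Lemma sphere_rot_gt0 i q : 0 < re (sphere_rot i q).
Proof.
rewrite /sphere_rot /=.
have [->|[s0 sc]] := share_cases i q; first by rewrite mul0r subr0; lra.
have [/andP[r1 r2] /andP[r3 r4]] := rest_bounds q.
have /andP[c1 c2] := dcos_bounds i q; have /andP[d1 d2] := dsin_bounds i q.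
have h1 : rest_im q * dsin i q <= 3 / 10 by nra.
have h2 : rest_re q * dcos i q <= - (7 / 10 * share i q) by nra.
have h3 : share i q * (rest_re q * dcos i q + rest_im q * dsin i q) <=
    share i q * (3 / 10 - 7 / 10 * share i q) by rewrite ler_pM2l//; lra.
nra.
Qed.

Lemma sphere_logE i q : cexp (sphere_log i q) = - sphere i q.
Proof.
rewrite cexpD plogK ?sphere_rot_gt0// /cexp /= expR0 !mul1r.
have cs : dcos i q ^+ 2 + dsin i q ^+ 2 = 1 by exact: cos2Dsin2.
rewrite -/(dcos i q) -/(dsin i q) /sphere_rot /sphere.
have c2 : dcos i q ^+ 2 = 1 - dsin i q ^+ 2 by rewrite -cs; ring.
apply/eqP; rewrite eq_complex /=; apply/andP; split; apply/eqP; ring: c2.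
Qed.

Lemma sphere_neq0 i q : sphere i q != 0.
Proof. by rewrite -oppr_eq0 -sphere_logE cexp_neq0. Qed.

Lemma cos_pi_lt0 (n : R) : cos (pi * n) < 0 -> 1 / 2 < `|n|.
Proof.
move=> c0; rewrite ltNge; apply/negP => n1; move: c0; apply/negP; rewrite -leNgt.
have p0 := pi_gt0 R; have : `|pi * n| <= pi / 2.
  by rewrite normrM gtr0_norm// ler_pM2l//; move: n1; rewrite mul1r.
by rewrite ler_norml; exact: cos_ge0_pihalf.
Qed.

(** Where the share is zero the arctangent term vanishes. Elsewhere [pi * dir i q] exceeds $\pi/2$
    in absolute value, so the arctangent cannot change its sign. *)
Lemma im_sphere_log_gt0 i q : (0 < im (sphere_log i q)) = (0 < dir i q).
Proof.
have p0 := pi_gt0 R; rewrite /sphere_log /plog /=.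
have [s0|[s0 sc]] := share_cases i q.
  by rewrite s0 !mul0r atan0 add0r pmulr_rgt0.
set t := (X in atan X); have := (atan_gtNpi2 t, atan_ltpi2 t) => -[t1 t2].
have := @cos_pi_lt0 (dir i q); rewrite -/(dcos i q) => h.
have {}h : 1 / 2 < `|dir i q| by apply: h; lra.
have [d0|d0] := ltrP 0 (dir i q).
  rewrite gtr0_norm// in h; have : pi * (1 / 2) < pi * dir i q by rewrite ltr_pM2l.
  move=> h2; apply/idP. lra.
rewrite ler0_norm// in h; have : pi * (1 / 2) < pi * - dir i q by rewrite ltr_pM2l.
by move=> h2; apply/negbTE; rewrite -leNgt; lra.
Qed.

Lemma continuous_dcos i : continuous (dcos i).
Proof.
apply: (@continuous_comp_fun _ _ _ (@cos R)); first exact: continuous_cos.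
exact: continuousM_fun (@cst_continuous _ _ pi) (@continuous_dir _ i).
Qed.

Lemma continuous_dsin i : continuous (dsin i).
Proof.
apply: (@continuous_comp_fun _ _ _ (@sin R)); first exact: continuous_sin.
exact: continuousM_fun (@cst_continuous _ _ pi) (@continuous_dir _ i).
Qed.

Lemma continuous_share i : continuous (share i).
Proof.
have cw j : continuous (weight j).
  exact: continuous_max_fun (@cst_continuous _ _ 0) (continuousN_fun (@continuous_dcos j)).
apply: (continuousM_fun (cw i)); apply: continuousV_fun.
  by move=> q; rewrite gt_eqF// (lt_le_trans ltr01)// total_ge1.
exact: continuousD_fun (continuousD_fun (cw 0) (cw 1)) (cw 2).
Qed.

Lemma continuous_rest_re : continuous rest_re.
Proof.
have ct k := @cst_continuous (R * R)%type R k.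
exact: continuousD_fun (ct 1) (continuousM_fun (ct (1 / 10)) (continuousD_fun
  (continuousD_fun (@continuous_dcos 0) (@continuous_dcos 1)) (@continuous_dcos 2))).
Qed.

Lemma continuous_rest_im : continuous rest_im.
Proof.
have ct k := @cst_continuous (R * R)%type R k.
exact: continuousM_fun (ct (1 / 10)) (continuousD_fun
  (continuousD_fun (@continuous_dsin 0) (@continuous_dsin 1)) (@continuous_dsin 2)).
Qed.

Lemma continuous_sphere i : continuous (sphere i).
Proof.
have ct := @cst_continuous (R * R)%type R (1 / 10).
apply/continuous_complexP; split.
  exact: continuousD_fun (continuousM_fun (@continuous_share i) continuous_rest_re)
   (continuousN_fun (continuousM_fun ct (@continuous_dcos i))).
exact: continuousD_fun (continuousM_fun (@continuous_share i) continuous_rest_im)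
   (continuousN_fun (continuousM_fun ct (@continuous_dsin i))).
Qed.

Lemma continuous_sphere_log i : continuous (sphere_log i).
Proof.
have ct := @cst_continuous (R * R)%type R (1 / 10).
have cR := continuous_rest_re; have cI := continuous_rest_im.
have cc := @continuous_dcos i; have cs := @continuous_dsin i.
have csh := @continuous_share i.
have crot : continuous (sphere_rot i).
  apply/continuous_complexP; split.
    exact: continuousD_fun ct (continuousN_fun (continuousM_fun csh
      (continuousD_fun (continuousM_fun cR cc) (continuousM_fun cI cs)))).
  exact: continuousM_fun csh
      (continuousD_fun (continuousM_fun cR cs) (continuousN_fun (continuousM_fun cI cc))).
apply: (continuousD_fun (continuous_plog crot (@sphere_rot_gt0 i))).
apply/continuous_complexP; split; first exact: cst_continuous.
exact: continuousM_fun (@cst_continuous _ _ pi) (@continuous_dir _ i).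
Qed.

Lemma sphere_boundary (x y : R) i : 0 <= x <= 1 -> 0 <= y <= 1 ->
  [|| x == 0, x == 1, y == 0 | y == 1] -> sphere i (x, y) = sphere i (0, 0).
Proof.
move=> x01 y01 b.
have dE j : dir j (x, y) = dir j (0, 0) by rewrite !dir_boundary ?lexx ?ler01 ?eqxx.
by rewrite /sphere /share /total /rest_re /rest_im /weight /dcos /dsin !dE.
Qed.

(** Logarithms are taken of [- H i], which moves the forbidden triple of arguments to the origin. At
    a common zero of their imaginary parts, provided by [common_zero], all three coordinates would
    be negative reals with sum 1. *)
Theorem sphere_not_null_homotopic (H : 'I_3 -> V -> R[i]) :
  (forall i, continuous (H i)) -> (forall i p, H i p != 0) ->
  (forall p, box p -> H 0 p + H 1 p + H 2 p = 1) ->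
  (forall i (x y : R), 0 <= x <= 1 -> 0 <= y <= 1 ->
    H i (1, x, y) = sphere i (x, y)) ->
  (forall i p, box p -> box_walls p -> H i p = sphere i (0, 0)) -> False.
Proof.
move=> cH H0 Hsum Hs Hw.
have lift i := @null_homotopy_lift R (fun p => - H i p) (sphere_log i)
  (sphere_log i (0, 0)).
have {lift} /choice[L LP] : forall i, exists L : V -> R[i], [/\ continuous L,
    forall p, box p -> cexp (L p) = - H i p,
    forall x y : R, 0 <= x <= 1 -> 0 <= y <= 1 -> L (1, x, y) = sphere_log i (x, y) &
    forall p, box p -> box_walls p -> L p = sphere_log i (0, 0)].
  move=> i; apply: lift => //.
  - exact: continuousN_fun (cH i).
  - exact: continuous_sphere_log.
  - by move=> p; rewrite oppr_eq0.
  - by move=> x y x01 y01; rewrite Hs// sphere_logE.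
  - by move=> p pK w; rewrite Hw// sphere_logE.
pose G i p := im (L i p).
have cG i : continuous (G i).
  by have [/continuous_complexP[_ ci] _ _ _] := LP i.
have [||p pK Gp] := common_zero cG.
- move=> x y x01 y01; rewrite /G.
  have LE i : L i (1, x, y) = sphere_log i (x, y) by have [_ _ h _] := LP i; exact: h.
  rewrite !LE !im_sphere_log_gt0 leNgt im_sphere_log_gt0 -leNgt dir0_le0.
  by split=> //; [exact: dir1_gt0|exact: dir2_gt0].
- move=> p pK w; rewrite /G.
  have LE i : L i p = sphere_log i (0, 0) by have [_ _ _ h] := LP i; exact: h.
  rewrite !LE !leNgt !im_sphere_log_gt0 !dir_boundary ?lexx ?ler01 ?eqxx//.
  by rewrite ltxx.
have neg i : re (H i p) < 0.
  have [_ /(_ p pK) LE _ _] := LP i.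
  rewrite -[H i p]opprK -LE /cexp -/(G i p) Gp cos0 sin0 /=.
  by rewrite mulr1 oppr_lt0 expR_gt0.
have := congr1 re (Hsum p pK).
move: (neg 0) (neg 1) (neg 2).
by case: (H 0 p) (H 1 p) (H 2 p) => [a ?] [b ?] [c ?] /=; lra.
Qed.

End Sphere.

(** * Affine coordinates on the complement of the arrangement *)

Lemma continuous_mx (T K : topologicalType) (m n : nat) (f : T -> 'M[K]_(m, n)) :
  (forall i j, continuous (fun x => f x i j)) -> continuous f.
Proof.
move=> cf x A [B Bf BA]; have h : \forall y \near x, forall i j, B i j (f y i j).
  apply: filter_forall => i; apply: filter_forall => j.
  exact: cf (Bf i j).
by apply: filterS h => y; exact: BA.
Qed.

Lemma continuous_mx_entry (K : topologicalType) (m n : nat) i j :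
  continuous (fun M : 'M[K]_(m, n) => M i j).
Proof.
move=> M A MA; exists (fun i' j' => if (i' == i) && (j' == j) then A else setT).
  move=> i' j'; case: ifP => [/andP[/eqP-> /eqP->]//|_]; exact: filterT.
by move=> N /(_ i j); rewrite !eqxx.
Qed.

Lemma nbhs_complex_neq0 (R : realType) (z : R[i]) : z != 0 ->
  nbhs z [set w | w != 0].
Proof.
move=> z0; apply/nbhs_complexP; exists (Order.max `|re z| `|im z|).
  rewrite lt_max !normr_gt0 -negb_and; apply: contra z0.
  by rewrite eq_complex.
move=> w hr hi; apply/eqP => w0; move: hr hi; rewrite w0 !sub0r !normrN.
by case: (leP `|re z| `|im z|); rewrite ltxx.
Qed.

Section ArrangementEquation.
Variable R : realType.
Implicit Types a u v x y z : R[i].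

Lemma arr_g_homogeneous i j a u v :
  arr_g i j (a * u) (a * v) = a ^+ (j.+1 - i) * arr_g i j u v.
Proof.
rewrite /arr_g -prodr_const_nat -big_split /=; apply: eq_bigr => k _; ring.
Qed.

Lemma arr_f_homogeneous_eq0 d1 d2 a x y z : a != 0 ->
  (arr_f d1 d2 (a * x) (a * y) (a * z) == 0) = (arr_f d1 d2 x y z == 0).
Proof.
move=> a0; rewrite /arr_f !arr_g_homogeneous -mulrBr !mulf_eq0 !expf_eq0.
by rewrite (negPf a0) !andbF.
Qed.

Lemma arr_g_neq0 (i j : nat) u v : arr_g i j u v != 0 <->
  forall k, (i <= k <= j)%N -> u - k%:R * v != 0.
Proof.
rewrite /arr_g prodf_seq_neq0; split=> [/allP h k ik|h].
  by apply: (implyP (h k _)); rewrite // mem_index_iota ltnS.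
by apply/allP => k; rewrite mem_index_iota ltnS => ik; exact: h.
Qed.

End ArrangementEquation.

(** * The affine chart, and what the vanishing of the second homotopy group gives in it *)

Section Coordinates.
Variable R : realType.
Local Notation V := (R * R * R)%type.

(** The coordinates $y/x$ and $z/x$, read on the chosen representative. By [proj_coord_pi] the
    choice does not matter where $x \ne 0$. *)
Definition proj_coord (j : 'I_3) (q : P2 R) : R[i] :=
  let v := set_val (repr q) in v 0 j / v 0 0.

Lemma P2_piE (v w : punctured_C3 R) :
  P2_pi v = P2_pi w <-> exists2 a : R[i], a != 0 & set_val w = a *: set_val v.
Proof.
split=> [/eqquotP/asboolP//|h]; apply/eqquotP; exact/asboolP.
Qed.

Lemma P2_repr_pi (v : punctured_C3 R) :
  exists2 a : R[i], a != 0 & set_val (repr (P2_pi v)) = a *: set_val v.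
Proof. by apply/P2_piE; rewrite /P2_pi reprK. Qed.

Lemma proj_coord_pi j (v : punctured_C3 R) : set_val v 0 0 != 0 ->
  proj_coord j (P2_pi v) = set_val v 0 j / set_val v 0 0.
Proof.
move=> v0; have [a a0 aE] := P2_repr_pi v; rewrite /proj_coord aE !mxE.
by rewrite -mulf_div divff// mul1r.
Qed.

(** The choice of representatives carries no continuity, so openness is checked on the preimage in
    the punctured space, where the function is a quotient of two entries. *)
Lemma open_proj_coord j (A : set R[i]) : open A ->
  open [set q : P2 R | set_val (repr q) 0 0 != 0 /\ A (proj_coord j q)].
Proof.
move=> oA; rewrite /open /= /quotient_open.
exists [set w : 'rV[R[i]]_3 | w 0 0 != 0 /\ A (w 0 j / w 0 0)].
  rewrite openE => w [w0 Aw].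
  have c k : {for w, continuous (fun M : 'rV[R[i]]_3 => M 0 k)}.
    exact: continuous_mx_entry.
  have cr : {for w, continuous (fun M : 'rV[R[i]]_3 => M 0 j / M 0 0)}.
    exact: (cvgM (c j) (cvgV w0 (c 0))).
  have n0 : \forall M \near w, (M : 'rV[R[i]]_3) 0 0 != 0.
    exact: (c 0 [set z | z != 0] (nbhs_complex_neq0 w0)).
  have nA : \forall M \near w, A ((M : 'rV[R[i]]_3) 0 j / M 0 0).
    exact: (cr A (open_nbhs_nbhs (conj oA Aw))).
  by apply: filterS2 n0 nA => M.
apply/seteqP; split=> v /=.
  move=> [v0 Av]; have [a a0 aE] := P2_repr_pi v.
  rewrite -/(P2_pi v) proj_coord_pi// aE mxE mulf_neq0//.
rewrite -/(P2_pi v); have [a a0 aE] := P2_repr_pi v.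
rewrite aE mxE mulf_eq0 (negPf a0) /= => -[v0].
by rewrite proj_coord_pi.
Qed.

Variables d1 d2 : nat.
Local Notation X := (arrangement_complement R d1 d2).

Lemma arrangement_repr_neq0 (p : X) :
  let v := set_val (repr (set_val p : P2 R)) in
  arr_f d1 d2 (v 0 0) (v 0 1) (v 0 2) != 0.
Proof.
apply/eqP => f0; have /set_mem /= := valP p; apply.
by exists (repr (set_val p : P2 R)) => //; rewrite /P2_pi reprK.
Qed.

(** Since $x$ divides $f$, the complement lies in one affine chart. *)
Lemma arrangement_x_neq0 (p : X) : set_val (repr (set_val p : P2 R)) 0 0 != 0.
Proof.
by have := arrangement_repr_neq0 p; rewrite /= /arr_f !mulf_eq0 !negb_or => /andP[/andP[/andP[]]].
Qed.

Lemma arrangement_affine_neq0 (p : X) :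
  arr_f d1 d2 1 (proj_coord 1 (set_val p)) (proj_coord 2 (set_val p)) != 0.
Proof.
have x0 := arrangement_x_neq0 p; have := arrangement_repr_neq0 p.
have xV0 : (set_val (repr (set_val p : P2 R)) 0 0)^-1 != 0 by rewrite invr_eq0.
rewrite /= -(arr_f_homogeneous_eq0 _ _ _ _ _ xV0).
by rewrite mulVf// ![_^-1 * _]mulrC.
Qed.

Lemma continuous_proj_coord j : continuous (fun p : X => proj_coord j (set_val p)).
Proof.
apply/continuousP => A oA.
exists [set q : P2 R | set_val (repr q) 0 0 != 0 /\ A (proj_coord j q)].
  exact: open_proj_coord.
by apply/seteqP; split=> p /= => [[]//|Ap]; split=> //; exact: arrangement_x_neq0.
Qed.

Definition affine_row (y z : R[i]) : 'rV[R[i]]_3 :=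
  \row_j match val j with 0%N => 1 | 1%N => y | _ => z end.

Lemma affine_row_neq0 y z : punctured_C3 R (affine_row y z).
Proof.
by apply/eqP => /matrixP/(_ 0 0); rewrite !mxE /=; apply/eqP; rewrite oner_eq0.
Qed.

Definition affine_point y z : P2 R :=
  P2_pi (SigSub (mem_set (affine_row_neq0 y z)) : punctured_C3 R).

Lemma affine_point_complement y z : arr_f d1 d2 1 y z != 0 ->
  (~` arrangement R d1 d2) (affine_point y z).
Proof.
move=> f0 [w /= fw /P2_piE[a a0]] wE; move: f0; apply/negP; rewrite negbK.
have wj j : affine_row y z 0 j = a * set_val w 0 j.
  by move/rowP: wE => /(_ j) h; apply: (etrans h); rewrite mxE.
have /eqP := fw; rewrite -(arr_f_homogeneous_eq0 _ _ _ _ _ a0) -!wj.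
by rewrite !mxE.
Qed.

Lemma proj_coord_affine1 y z : proj_coord 1 (affine_point y z) = y.
Proof. by rewrite proj_coord_pi /= !mxE /= ?divr1 ?oner_eq0. Qed.

Lemma proj_coord_affine2 y z : proj_coord 2 (affine_point y z) = z.
Proof. by rewrite proj_coord_pi /= !mxE /= ?divr1 ?oner_eq0. Qed.

Lemma continuous_affine_point (T : topologicalType) (y z : T -> R[i]) :
  continuous y -> continuous z -> continuous (fun t => affine_point (y t) (z t)).
Proof.
move=> cy cz.
apply: (@continuous_comp_fun _ _ _ (@P2_pi R)
  (fun t => SigSub (mem_set (affine_row_neq0 (y t) (z t))) : punctured_C3 R)).
  exact: pi_continuous.
apply: continuous_comp_initial; apply: continuous_mx => i j.
under eq_fun => t do rewrite /= mxE.
case: j => -[|[|j]] ltj /=; [exact: cst_continuous|exact: cy|exact: cz].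
Qed.

Definition cube_pair (s : cube R 2) : R * R := (set_val s 0 0, set_val s 0 1).

Lemma continuous_cube_pair : continuous cube_pair.
Proof.
apply: continuous_pair;
  apply: (@continuous_comp_fun _ _ _ (fun M : 'rV[R]_2 => M 0 _) set_val);
  by [exact: continuous_mx_entry|exact: initial_continuous].
Qed.

Lemma cube_pair_itv (s : cube R 2) :
  0 <= (cube_pair s).1 <= 1 /\ 0 <= (cube_pair s).2 <= 1.
Proof.
have /set_mem /= sP := valP s.
by have := (sP 0, sP 1); rewrite /unit_interval /= !in_itv /= => -[].
Qed.

Definition pair_row (x y : R) : 'rV[R]_2 :=
  \row_j clamp01 (if val j == 0%N then x else y).

Lemma pair_row_cube x y : cube R 2 (pair_row x y).
Proof. by move=> j; rewrite /unit_interval /= in_itv mxE; exact: clamp01_itv. Qed.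

Lemma clamp01_unit (t : R) : unit_interval R (clamp01 t).
Proof. by rewrite /unit_interval /= in_itv; exact: clamp01_itv. Qed.

(** Clamping makes this map total on $R^3$, so that a homotopy on the cylinder pulls back to
    functions of three real variables. *)
Definition to_cylinder (p : V) : unit_interval R * cube R 2 :=
  (SigSub (mem_set (clamp01_unit p.1.1)), SigSub (mem_set (pair_row_cube p.1.2 p.2))).

Lemma continuous_to_cylinder : continuous to_cylinder.
Proof.
apply: continuous_pair; apply: continuous_comp_initial.
  exact: continuous_comp_fun (@continuous_clamp01 R) (@continuous_coord1 R).
apply: continuous_mx => i j; under eq_fun => t do rewrite /= mxE.
case: j => -[|j] ltj /=; first
  exact: continuous_comp_fun (@continuous_clamp01 R) (@continuous_coord2 R).
exact: continuous_comp_fun (@continuous_clamp01 R) (@continuous_coord3 R).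
Qed.

Lemma cube_pair_to_cylinder (p : V) : box p ->
  cube_pair (to_cylinder p).2 = (p.1.2, p.2).
Proof. by move=> /boxP[_ h1 h2]; rewrite /cube_pair /= !mxE /= !clamp01_id. Qed.

Lemma time_to_cylinder (p : V) : box p -> set_val (to_cylinder p).1 = p.1.1.
Proof. by move=> /boxP[h _ _]; exact: clamp01_id h. Qed.

Lemma cube_boundaryE (s : cube R 2) : cube_boundary s <->
  [|| (cube_pair s).1 == 0, (cube_pair s).1 == 1, (cube_pair s).2 == 0
    | (cube_pair s).2 == 1].
Proof.
split; last by case/or4P => /eqP; [exists 0|exists 0|exists 1|exists 1]; auto.
have ord2 (i : 'I_2) : i = 0 \/ i = 1.
  by case: i => -[|[|//]] lti; [left|right]; exact: val_inj.
move=> [j]; case: (ord2 j) => -> [] sE; rewrite /cube_pair /= sE eqxx ?orbT//.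
Qed.

Lemma Kpi1_null_homotopy (fy fz : R * R -> R[i]) :
  is_Kpi1 R X -> continuous fy -> continuous fz ->
  (forall q, 0 <= q.1 <= 1 -> 0 <= q.2 <= 1 -> arr_f d1 d2 1 (fy q) (fz q) != 0) ->
  (forall x y : R, 0 <= x <= 1 -> 0 <= y <= 1 ->
    [|| x == 0, x == 1, y == 0 | y == 1] ->
    fy (x, y) = fy (0, 0) /\ fz (x, y) = fz (0, 0)) ->
  exists Y Z : V -> R[i], [/\ continuous Y, continuous Z,
    forall p, arr_f d1 d2 1 (Y p) (Z p) != 0,
    forall x y : R, 0 <= x <= 1 -> 0 <= y <= 1 ->
      Y (1, x, y) = fy (x, y) /\ Z (1, x, y) = fz (x, y) &
    forall p, box p -> box_walls p -> Y p = fy (0, 0) /\ Z p = fz (0, 0)].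
Proof.
move=> [_ /(_ _ 2%N isT) van] cfy cfz f0 fb.
have f0' s : (~` arrangement R d1 d2)
    (affine_point (fy (cube_pair s)) (fz (cube_pair s))).
  have [h1 h2] := cube_pair_itv s; exact/affine_point_complement/f0.
pose F s : X := SigSub (mem_set (f0' s)).
have cF : continuous F.
  apply: continuous_comp_initial; apply: continuous_affine_point.
    exact: continuous_comp_fun cfy continuous_cube_pair.
  exact: continuous_comp_fun cfz continuous_cube_pair.
pose x0 := F (to_cylinder (0, 0, 0)).2.
have box00 : box (0, 0, 0 : R) by apply/boxP; rewrite /= lexx ler01.
have FsE s : set_val (F s) = affine_point (fy (cube_pair s)) (fz (cube_pair s)) by [].
have x0E : set_val x0 = affine_point (fy (0, 0)) (fz (0, 0)).
  by rewrite /x0 FsE (cube_pair_to_cylinder box00).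
have FE s : cube_boundary s -> F s = x0.
  move=> /cube_boundaryE sb; apply: val_inj; rewrite [RHS]x0E [LHS]FsE.
  have [h1 h2] := cube_pair_itv s.
  by have := fb _ _ h1 h2 sb; rewrite -surjective_pairing => -[-> ->].
pose f := Spheroid cF FE.
(* The only class is that of the constant spheroid, and [f] lies in its own class by the stationary
   homotopy. The homotopy obtained starts at the constant, so the spheroid sits on the face
   [t = 1]. *)
have : homotopy_class (cst_spheroid R 2 x0) f.
  have : @homotopy_group R X 2 x0 (homotopy_class f) by exists f.
  rewrite (van x0) /= => <-; exists (fun ts => f ts.2); split.
  - by apply: (continuous_comp_fun cF) => ts; exact: cvg_snd.
  - by [].
  - by [].
  - by move=> t s sb; exact: (FE s sb).
move=> [H [cH H0 H1 Hb]].
exists (fun p => proj_coord 1 (set_val (H (to_cylinder p)))).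
exists (fun p => proj_coord 2 (set_val (H (to_cylinder p)))).
have cHc := continuous_comp_fun cH continuous_to_cylinder.
split.
- exact: continuous_comp_fun (@continuous_proj_coord 1) cHc.
- exact: continuous_comp_fun (@continuous_proj_coord 2) cHc.
- by move=> p; exact: arrangement_affine_neq0.
- move=> x y x01 y01.
  have pK : box (1, x, y) by apply/boxP; rewrite /= lexx ler01.
  have -> : H (to_cylinder (1, x, y)) = F (to_cylinder (1, x, y)).2.
    by rewrite [to_cylinder _]surjective_pairing H1//; exact: time_to_cylinder pK.
  rewrite FsE (cube_pair_to_cylinder pK).
  by rewrite proj_coord_affine1 proj_coord_affine2.
- move=> p pK w.
  have -> : H (to_cylinder p) = x0.
    rewrite [to_cylinder _]surjective_pairing; case/orP: w => [/eqP p0|w].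
      by rewrite H0//; apply: (etrans (time_to_cylinder pK)).
    apply: Hb; apply/cube_boundaryE.
    by rewrite (cube_pair_to_cylinder pK).
  by rewrite x0E proj_coord_affine1 proj_coord_affine2.
Qed.

End Coordinates.

(** * The essential sphere realised in the two kinds of complements *)

Section NotKpi1.
Variable R : realType.
Local Notation V := (R * R * R)%type.

Lemma sphere2E (q : R * R) : sphere 2 q = 1 - sphere 0 q - sphere 1 q.
Proof. by rewrite -(sphere_sum q); ring. Qed.

(** In the chart $x = 1$, the forms $2(1-y)$, $2(y-z)$ and $2z-1$ have sum 1. Setting them equal to
    the three coordinates of [sphere] defines [fy] and [fz]; the same forms carry a null homotopy
    back. *)
Lemma pencil_not_Kpi1 (d2 : nat) : (2 <= d2)%N ->
  ~ is_Kpi1 R (arrangement_complement R 2 d2).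
Proof.
move=> d22 K.
have cC k : continuous (cst k : R * R -> R[i]) by exact: cst_continuous.
have cV k : continuous (cst k : V -> R[i]) by exact: cst_continuous.
pose fy (q : R * R) := 1 - 2^-1 * sphere 0 q.
pose fz (q : R * R) := 2^-1 + 2^-1 * sphere 2 q.
have cfy : continuous fy.
  exact: continuousD_fun (cC 1) (continuousN_fun (continuousM_fun (cC 2^-1)
    (@continuous_sphere R 0))).
have cfz : continuous fz.
  exact: continuousD_fun (cC 2^-1) (continuousM_fun (cC 2^-1)
    (@continuous_sphere R 2)).
have [|x y x01 y01 b|Y [Z [cY cZ YZ0 YZ1 YZw]]] := Kpi1_null_homotopy K cfy cfz.
- move=> q _ _; rewrite /arr_f !mulf_eq0 !negb_or oner_eq0 /=.
  apply/andP; split; first (apply/andP; split).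
  + have -> : fy q - fz q = 2^-1 * sphere 1 q.
      by rewrite /fy /fz sphere2E; field.
    by rewrite mulf_neq0 ?sphere_neq0// invr_eq0 pnatr_eq0.
  + apply/arr_g_neq0 => k; rewrite -eqn_leq => /eqP <-.
    have -> : 1 - 1%:R * fy q = 2^-1 * sphere 0 q by rewrite /fy; ring.
    by rewrite mulf_neq0 ?sphere_neq0// invr_eq0 pnatr_eq0.
  + apply/arr_g_neq0 => k /andP[]; rewrite leq_eqVlt => /orP[/eqP <- _|k3 _].
      have -> : 1 - 2%:R * fz q = - sphere 2 q by rewrite /fz; field.
      by rewrite oppr_eq0 sphere_neq0.
    (* The remaining lines $1 = kz$ with $k \ge 3$ would require $k(1 + c) = 2$ for $c$ the third
       coordinate, whose real part is at least $-1/10$. *)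
    have [+ _ _ _] := sphere_bounds 2 q; apply: contraTN => /eqP e0.
    have : k%:R * (1 + sphere 2 q) = 2.
      by rewrite -[RHS]subr0 -[X in _ = _ - X](mulr0 2) -e0 /fz; field.
    rewrite -!(rmorph_nat (real_complex R)).
    case: (sphere 2 q) => a b /(congr1 re) /=; rewrite mul0r subr0.
    by have : 3 <= k%:R :> R; [rewrite ler_nat|rewrite -ltNge; nra].
- by rewrite /fy /fz !(sphere_boundary _ x01 y01 b).
have Y0 p : [/\ Y p - Z p != 0, 1 - Y p != 0 & 1 - 2 * Z p != 0].
  have := YZ0 p; rewrite /arr_f !mulf_eq0 !negb_or => /andP[/andP[/andP[_ h0]]].
  move=> /arr_g_neq0/(_ 1%N isT) h1 /arr_g_neq0/(_ 2%N d22) h2.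
  by rewrite mul1r in h1; split.
pose H (i : 'I_3) (p : V) := match val i with
  | 0%N => 2 * (1 - Y p) | 1%N => 2 * (Y p - Z p) | _ => - (1 - 2 * Z p) end.
have n2 : 2 != 0 :> R[i] by rewrite pnatr_eq0.
apply: (@sphere_not_null_homotopic R H).
- elim/ord3_ind; rewrite /H /=.
  + exact: continuousM_fun (cV 2) (continuousD_fun (cV 1) (continuousN_fun cY)).
  + exact: continuousM_fun (cV 2) (continuousD_fun cY (continuousN_fun cZ)).
  + exact: continuousN_fun (continuousD_fun (cV 1) (continuousN_fun (continuousM_fun (cV 2) cZ))).
- move=> i p; have [h0 h1 h2] := Y0 p.
  by elim/ord3_ind: i; rewrite /H /= ?oppr_eq0 ?mulf_neq0.
- by move=> p _; rewrite /H /=; ring.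
- move=> i x y x01 y01; have [YE ZE] := YZ1 x y x01 y01.
  by elim/ord3_ind: i; rewrite /H /= ?YE ?ZE /fy /fz ?sphere2E; field.
- move=> i p pK w; have [YE ZE] := YZw p pK w.
  by elim/ord3_ind: i; rewrite /H /= ?YE ?ZE /fy /fz ?sphere2E; field.
Qed.

(** For $0 < s < 2\pi$ one has $\cos s = 1 - 2\sin^2(s/2)$ with $\sin(s/2) > 0$; parity covers
    negative angles. *)
Lemma cos_eq1_lt2pi (t : R) : - (2 * pi) < t < 2 * pi -> cos t = 1 -> t = 0.
Proof.
have pos (s : R) : 0 < s < 2 * pi -> cos s != 1.
  move=> /andP[s0 s2]; apply/eqP => c1.
  have : 0 < sin (s / 2) by apply: sin_gt0_pi; lra.
  have := cosD (s / 2) (s / 2); rewrite -splitr c1.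
  have := cos2Dsin2 (s / 2); nra.
move=> /andP[t1 t2] c1; case: (ltgtP t 0) => // t0; exfalso.
  by have /eqP := pos (- t) ltac:(lra); rewrite cosN; apply.
by have /eqP := pos t ltac:(lra); apply.
Qed.

Definition log_third : R[i] := (- ln 3) +i* pi.

Lemma cexp_log_third : cexp log_third = - 3^-1.
Proof.
rewrite /cexp /= cospi sinpi mulr0 expRN lnK ?posrE//.
have -> : 3^-1 = (3^-1)%:C :> R[i] by rewrite fmorphV rmorph_nat.
by apply/eqP; rewrite eq_complex /= mulrN1 !oppr0 !eqxx.
Qed.

Lemma log_third_neq0 : log_third != 0.
Proof. by rewrite eq_complex /= (gt_eqF (pi_gt0 R)) andbF. Qed.

(** The bounds on the sphere keep the imaginary part of the exponent strictly between $-2\pi$ and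
    $2\pi$, so the exponential could be 1 only if the exponent were 0. *)
Lemma cexp_sphere_neq1 i (q : R * R) : cexp (log_third * sphere i q) != 1.
Proof.
apply/eqP => /cexp_eq1[r0 c1].
have ln0 : 0 <= ln 3 :> R by apply: ln_ge0; rewrite ler1n.
(* From $\ln(1 + t) \le t$ at $t = 2$. *)
have ln2 : ln 3 <= 2 :> R.
  by have := @le_ln1Dx R 2; rewrite (_ : 1 + 2 = 3) => [|]; [apply; lra|lra].
have p2 : 2 <= pi :> R := pi_ge2 R.
have i0 : im (log_third * sphere i q) = 0.
  apply: cos_eq1_lt2pi => //; have [] := sphere_bounds i q.
  case: (sphere i q) => a b /= a1 a2 b1 b2.
  by apply/andP; split; nra.
have := mulf_neq0 log_third_neq0 (sphere_neq0 i q).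
by rewrite eq_complex r0 i0 !eqxx.
Qed.

Lemma cexp_log_third_sphere2 (q : R * R) :
  cexp (log_third * sphere 0 q) * cexp (log_third * sphere 1 q) =
  - 3^-1 / cexp (log_third * sphere 2 q).
Proof.
by rewrite -cexp_log_third -cexpD -cexpB sphere2E; congr cexp; ring.
Qed.

(** With $u_0 = 2y-1$, $u_0u_1 = 2z-1$ and $u_0u_1u_2 = -1/3$, the factors of $f$ at $x = 1$ are
    $(1-u_0)/2$, $-u_0$, $u_0(1-u_1)/2$, $-u_0u_1$ and $(1-u_2)/(2u_2)$. The sphere is realised by
    $u_i = e^{\tau s_i}$, where the $s_i$ are its coordinates; a null homotopy is carried back by
    logarithms divided by $\tau$. *)
Lemma X3_not_Kpi1 : ~ is_Kpi1 R (arrangement_complement R 3 3).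
Proof.
move=> K.
have n2 : 2 != 0 :> R[i] by rewrite pnatr_eq0.
have cC k : continuous (cst k : R * R -> R[i]) by exact: cst_continuous.
have cV k : continuous (cst k : V -> R[i]) by exact: cst_continuous.
pose l i (q : R * R) := log_third * sphere i q.
pose u i (q : R * R) := cexp (l i q).
have cl i : continuous (l i) := continuousM_fun (cC log_third) (@continuous_sphere R i).
have cu i : continuous (u i) := continuous_comp_fun (@continuous_cexp R) (cl i).
have u0 i q : u i q != 0 by exact: cexp_neq0.
have u1 i q : u i q != 1 by exact: cexp_sphere_neq1.
have uu q : u 0 q * u 1 q = - 3^-1 / u 2 q by exact: cexp_log_third_sphere2.
pose fy q := 2^-1 * (1 + u 0 q).
pose fz q := 2^-1 * (1 + u 0 q * u 1 q).
have cfy : continuous fy.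
  exact: continuousM_fun (cC 2^-1) (continuousD_fun (cC 1) (cu 0)).
have cfz : continuous fz.
  exact: continuousM_fun (cC 2^-1)
    (continuousD_fun (cC 1) (continuousM_fun (cu 0) (cu 1))).
have [|x y x01 y01 b|Y [Z [cY cZ YZ0 YZ1 YZw]]] := Kpi1_null_homotopy K cfy cfz.
- move=> q _ _; rewrite /arr_f !mulf_eq0 !negb_or oner_eq0 /=.
  apply/andP; split; first (apply/andP; split).
  + have -> : fy q - fz q = 2^-1 * (u 0 q * (1 - u 1 q)).
      by rewrite /fy /fz; ring.
    by rewrite !mulf_neq0 ?invr_eq0// subr_eq0 eq_sym.
  + apply/arr_g_neq0 => k /andP[]; rewrite leq_eqVlt => /orP[/eqP <- _|k2 k3].
      have -> : 1 - 1%:R * fy q = 2^-1 * (1 - u 0 q) by rewrite /fy; field.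
      by rewrite mulf_neq0 ?invr_eq0// subr_eq0 eq_sym.
    have -> : k = 2%N by apply/eqP; rewrite eqn_leq k3.
    have -> : 1 - 2%:R * fy q = - u 0 q by rewrite /fy; field.
    by rewrite oppr_eq0.
  + apply/arr_g_neq0 => k /andP[]; rewrite leq_eqVlt => /orP[/eqP <- _|k2 k3].
      have -> : 1 - 2%:R * fz q = - (u 0 q * u 1 q) by rewrite /fz; field.
      by rewrite oppr_eq0 mulf_neq0.
    have -> : k = 3%N by apply/eqP; rewrite eqn_leq k3.
    have -> : 1 - 3%:R * fz q = 2^-1 * ((1 - u 2 q) / u 2 q).
      by rewrite /fz uu; field; rewrite u0.
    by rewrite !mulf_neq0 ?invr_eq0// subr_eq0 eq_sym.
- by rewrite /fy /fz /u /l !(sphere_boundary _ x01 y01 b).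
have Y0 p : [/\ Y p - Z p != 0, 1 - Y p != 0, 1 - 2 * Y p != 0,
    1 - 2 * Z p != 0 & 1 - 3 * Z p != 0].
  have := YZ0 p; rewrite /arr_f !mulf_eq0 !negb_or => /andP[/andP[/andP[_ h0]]].
  move=> /arr_g_neq0 hy /arr_g_neq0 hz.
  by have := hy 1%N isT; rewrite mul1r; split => //; [exact: hy|exact: hz|exact: hz].
(* [U] and [W] recover [u 0] and [u 1] along the homotopy. *)
pose U p := 2 * Y p - 1; pose W p := (2 * Z p - 1) / U p.
have U0 p : U p != 0 by have [_ _ + _ _] := Y0 p; rewrite -opprB oppr_eq0.
have W0 p : W p != 0.
  rewrite mulf_neq0 ?invr_eq0//.
  by have [_ _ _ + _] := Y0 p; rewrite -opprB oppr_eq0.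
have cU : continuous U := continuousD_fun (continuousM_fun (cV 2) cY) (cV (- 1)).
have cW : continuous W := continuousM_fun
  (continuousD_fun (continuousM_fun (cV 2) cZ) (cV (- 1))) (continuousV_fun U0 cU).
have UE (y : R[i]) : 2 * (2^-1 * (1 + y)) - 1 = y by field.
have [|p pK w||L0 [cL0 L0E L01 L0w]] := @null_homotopy_lift R U (l 0) (l 0 (0, 0)) cU (cl 0) U0.
- by move=> x y x01 y01; rewrite /U (YZ1 x y x01 y01).1 UE.
- by rewrite /U (YZw p pK w).1 UE.
- by [].
have [|p pK w||L1 [cL1 L1E L11 L1w]] := @null_homotopy_lift R W (l 1) (l 1 (0, 0)) cW (cl 1) W0.
- move=> x y x01 y01; rewrite /W /U (YZ1 x y x01 y01).1 (YZ1 x y x01 y01).2 !UE.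
  by rewrite mulrC mulKf.
- by rewrite /W /U (YZw p pK w).1 (YZw p pK w).2 !UE mulrC mulKf.
- by [].
(* The lifts are logarithms on the box only, whereas [H] must be nonzero on all of $R^3$;
   composition with the retraction reconciles the two. *)
pose rho := @scaled_clamp R 1.
have rhoK p : box (rho p) by apply: box_scaled_clamp; rewrite ler01 lexx.
have crho : continuous rho := @continuous_scaled_clamp R 1.
have rhoE p : box p -> rho p = p by exact: scaled_clamp1.
have t0 := log_third_neq0.
pose H (i : 'I_3) (p : V) := match val i with
  | 0%N => log_third^-1 * L0 (rho p) | 1%N => log_third^-1 * L1 (rho p)
  | _ => 1 - log_third^-1 * L0 (rho p) - log_third^-1 * L1 (rho p) end.
have cH0 : continuous (H 0) := continuousM_fun (cV log_third^-1) (continuous_comp_fun cL0 crho).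
have cH1 : continuous (H 1) := continuousM_fun (cV log_third^-1) (continuous_comp_fun cL1 crho).
apply: (@sphere_not_null_homotopic R H).
- elim/ord3_ind; [exact: cH0|exact: cH1|].
  exact: continuousD_fun (continuousD_fun (cV 1) (continuousN_fun cH0)) (continuousN_fun cH1).
- move=> i p; have [h0 h1 h2 h3 h4] := Y0 (rho p).
  have e0 := L0E _ (rhoK p); have e1 := L1E _ (rhoK p).
  elim/ord3_ind: i; rewrite /H /=.
  + rewrite mulf_neq0 ?invr_eq0//; apply: contra_neq h1 => l0.
    have -> : 1 - Y (rho p) = 2^-1 * (1 - U (rho p)) by rewrite /U; field.
    by rewrite -e0 l0 cexp0 subrr mulr0.
  + rewrite mulf_neq0 ?invr_eq0//; apply: contra_neq h0 => l0.
    have -> : Y (rho p) - Z (rho p) = 2^-1 * (U (rho p) - (2 * Z (rho p) - 1)).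
      by rewrite /U; field.
    by rewrite -[2 * Z _ - 1](divfK (U0 (rho p))) -/(W _) -e1 l0 cexp0 mul1r subrr mulr0.
  (* If the third coordinate vanishes, the two logarithms add up to [log_third]; hence $2z - 1 =
     -1/3$ and $1 - 3z = 0$. *)
  + apply: contra_neq h4 => l0.
    have ZE : 2 * Z (rho p) - 1 = - 3^-1.
      rewrite -[LHS](divfK (U0 (rho p))) -/(W _) -e1 -e0 -cexpD -cexp_log_third.
      congr cexp; rewrite -[RHS]subr0 -[X in _ = _ - X](mulr0 log_third) -l0.
      by field.
    have -> : 1 - 3 * Z (rho p) = - (3 / 2) * (2 * Z (rho p) - 1 + 3^-1) by field.
    by rewrite ZE addNr mulr0.
- by move=> p _; rewrite /H /=; ring.
- move=> i x y x01 y01.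
  have pK : box (1, x, y) by apply/boxP; rewrite /= lexx ler01.
  by elim/ord3_ind: i; rewrite /H /= rhoE// ?L01// ?L11// ?sphere2E /l ?mulKf.
- move=> i p pK w.
  by elim/ord3_ind: i; rewrite /H /= rhoE// ?L0w// ?L1w// ?sphere2E /l ?mulKf.
Qed.
End NotKpi1.

Theorem proposition4p3 (R : realType) (d1 d2 : nat)
    (hd1 : (2 <= d1)%N) (hd12 : (d1 <= d2)%N) :
  d1 = 2%N \/ (d1 = 3%N /\ d2 = 3%N) ->
  ~ is_Kpi1 R (arrangement_complement R d1 d2).
Proof.
move=> [d12|[-> ->]]; last exact: X3_not_Kpi1.
by rewrite d12 in hd12 *; exact: pencil_not_Kpi1.
Qed.
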